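(* Let $\bar\varepsilon\in\mathcal{U}_e$ be given and let $\mathcal{P}:\mathcal{H}_s\times\mathcal{H}_e\to\mathbb{R}$ be $$\mathcal{P}(\tau,\eta)=\tfrac12\|(I-P_{\mathcal{E}_0})\eta-\bar\varepsilon\|^2_{\mathcal{H}_e}+\langle r(\cdot,\tau,\eta)\rangle+\tfrac12\|P_{\mathcal{S}^\perp}\tau\|^2_{\mathcal{H}_s},\qquad r(x,\tau,\eta)=\tfrac12(\tau-L\eta):L^{-1}(\tau-L\eta).$$ The partial gradients of $\mathcal{P}$ with respect to $\tau$ and to $\eta$, in $\mathcal{H}_s$ and $\mathcal{H}_e$ respectively, each endowed with its energetic scalar product, are given for all $(\tau,\eta)\in\mathcal{H}_s\times\mathcal{H}_e$ by $$\nabla_{\tau}\mathcal{P}(\tau,\eta)=L_0\big(L^{-1}\tau-\eta\big)+P_{\mathcal{S}^\perp}\tau,$$ $$\nabla_{\eta}\mathcal{P}(\tau,\eta)=L_0^{-1}\big(L\eta-\tau\big)+(I-P_{\mathcal{E}_0})\eta-\bar\varepsilon.$$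
   Context: Let $\mathcal{V}\subset\mathbb{R}^d$ be a unit cell that tiles $\mathbb{R}^d$ by translation along a lattice $\mathcal{R}$ generated by $d$ vectors. ''Periodic'' means $\mathcal{R}$-periodic. $L^2_{\mathrm{per}}(\mathcal{V})$ is the space of periodic functions in $L^2_{\mathrm{loc}}(\mathbb{R}^d)$, and $H^1_{\mathrm{per}}(\mathcal{V})$ the space of periodic functions in $H^1_{\mathrm{loc}}(\mathbb{R}^d)$. All fields are real-valued. Write $\langle f\rangle=\frac1{|\mathcal{V}|}\int_{\mathcal{V}}f\,dx$ and $s:e=\sum_{i,j}s_{ij}e_{ij}$. $L_0$ is a uniform (constant in $x$) positive definite fourth-order tensor with major and minor symmetries; it acts on second-order tensors, $(L_0\eta)_{ij}=\sum_{k,l}(L_0)_{ijkl}\eta_{kl}$, and it is thus an invertible, symmetric positive definite linear map on symmetric $d\times d$ matrices. $L=L(x)$ is the periodic fourth-order elasticity tensor field of the composite, with major and minor symmetries, components in $L^\infty(\mathcal{V})$, and uniformly positive definite (there is $\mu>0$ with $L(x)e:e\ge\mu\, e:e$ for a.e. $x$ and all symmetric $e$); it acts pointwise, $(L\eta)(x)=L(x)\eta(x)$, and $L^{-1}$ is its pointwise inverse on symmetric matrices. $\mathcal{H}_e$ (strain fields) is the space of symmetric second-order tensor fields with components in $L^2_{\mathrm{per}}(\mathcal{V})$, with energetic scalar product $(\eta,\tilde\eta)_{\mathcal{H}_e}=\langle L_0\eta:\tilde\eta\rangle$. $\mathcal{H}_s$ (stress fields) is the same set of tensor fields, with energetic scalar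 product $(\tau,\tilde\tau)_{\mathcal{H}_s}=\langle\tau:L_0^{-1}\tilde\tau\rangle$. $\|\cdot\|_{\mathcal{H}_e}$, $\|\cdot\|_{\mathcal{H}_s}$ are the associated norms and $I$ is the identity operator. $\mathcal{U}_e\subset\mathcal{H}_e$ is the subspace of uniform (constant) fields. $\mathcal{E}_0=\{e^*\in\mathcal{H}_e:\ \exists\,w^*\in H^1_{\mathrm{per}}(\mathcal{V})^d,\ e^*=\frac12(\nabla w^*+(\nabla w^* )^{\top})\}$. $\mathcal{S}$ is the space of $s\in\mathcal{H}_s$ such that $\operatorname{div}s=0$ in $\mathcal{V}$ and $s\cdot n$ is anti-periodic on $\partial\mathcal{V}$ ($n$ the unit outward normal), i.e. the periodic field $s$ is divergence-free on $\mathbb{R}^d$ in the sense of distributions. $P_{\mathcal{E}_0}$ is the orthogonal projector of $\mathcal{H}_e$ onto $\mathcal{E}_0$; $P_{\mathcal{S}^\perp}$ is the orthogonal projector of $\mathcal{H}_s$ onto the orthogonal complement $\mathcal{S}^\perp$ of $\mathcal{S}$ in $\mathcal{H}_s$ (orthogonality for the respective energetic scalar products). The partial gradients are the elements $\nabla_\tau\mathcal{P}(\tau,\eta)\in\mathcal{H}_s$ and $\nabla_\eta\mathcal{P}(\tau,\eta)\in\mathcal{H}_e$ such that $(\nabla_\tau\mathcal{P}(\tau,\eta),\tilde\tau)_{\mathcal{H}_s}=\lim_{t\to0}\frac{\mathcal{P}(\tau+t\tilde\tau,\eta)-\mathcal{P}(\tau,\eta)}{t}$ for all $\tilde\tau\in\mathcal{H}_s$,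 and $(\nabla_\eta\mathcal{P}(\tau,\eta),\tilde\eta)_{\mathcal{H}_e}=\lim_{t\to0}\frac{\mathcal{P}(\tau,\eta+t\tilde\eta)-\mathcal{P}(\tau,\eta)}{t}$ for all $\tilde\eta\in\mathcal{H}_e$. *)

(* Defs.v *)
From HB Require Import structures.
From mathcomp Require Import all_boot all_order all_algebra.
From mathcomp Require Import all_classical all_reals all_analysis.
Set Implicit Arguments.
Unset Strict Implicit.
Unset Printing Implicit Defensive.
Import Order.TTheory GRing.Theory Num.Theory.
Import numFieldNormedType.Exports.
Local Open Scope classical_set_scope.
Local Open Scope ring_scope.

(** * Lebesgue measure on R^n.+1

The outer measure is the infimum of the total volumes of the countable
coverings by half-open boxes [a, b[ (empty, of volume 0, as soon as
b i <= a i for some i); the Lebesgue sigma-algebra is the one of its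
Caratheodory-measurable sets, on which it is a complete measure. *)
Section lebesgue_outer_measure.
Context (R : realType) (n : nat).
Local Notation Rn := 'rV[R]_n.+1.

Definition box (ab : Rn * Rn) : set Rn :=
  [set x | forall i, ab.1 ord0 i <= x ord0 i < ab.2 ord0 i].

Definition box_volume (ab : Rn * Rn) : R :=
  \prod_i Num.max 0 (ab.2 ord0 i - ab.1 ord0 i).

Definition box_cover (X : set Rn) : set (nat -> Rn * Rn) :=
  [set F | X `<=` \bigcup_k box (F k)].

Local Open Scope ereal_scope.

Definition lebesgue_outer (X : set Rn) : \bar R :=
  ereal_inf [set \sum_(k <oo) (box_volume (F k))%:E | F in box_cover X].

Let vol (ab : Rn * Rn) : \bar R := (box_volume ab)%:E.

Let vol_ge0 ab : 0 <= vol ab.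
Proof. by rewrite lee_fin; apply: prodr_ge0 => i _; rewrite le_max lexx. Qed.

Lemma le_lebesgue_outer : {homo lebesgue_outer : A B / A `<=` B >-> A <= B}.
Proof.
move=> A B AB; apply/ereal_inf_le_tmp => x [F BF].
by move=> <-{x}; exists F => //; apply: subset_trans AB BF.
Qed.

Lemma lebesgue_outer_ge0 A : 0 <= lebesgue_outer A.
Proof.
apply: le_ereal_inf_tmp => x [F AF <-{x}].
by apply: nneseries_ge0 => k _ _; exact: vol_ge0.
Qed.

Lemma lebesgue_outer0 : lebesgue_outer set0 = 0.
Proof.
apply/eqP; rewrite eq_le; apply/andP; split; last exact/lebesgue_outer_ge0.
apply: ereal_inf_lbound; exists (fun=> (0%R, 0%R)) => //.
rewrite eseries0// => k _ _; congr EFin.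
by rewrite /box_volume big_ord_recl subrr maxxx mul0r.
Qed.

Lemma lebesgue_outer_sigma_subadditive : sigma_subadditive lebesgue_outer.
Proof.
move=> A; have [[i ioo]|] := pselect (exists i, lebesgue_outer (A i) = +oo).
  rewrite (eseries_pinfty _ _ ioo) ?leey// => k _.
  by rewrite -ltNye (lt_le_trans _ (lebesgue_outer_ge0 _)).
rewrite -forallNE => Aoo.
suff add2e (e : {posnum R}) : lebesgue_outer (\bigcup_n A n) <=
    \sum_(i <oo) lebesgue_outer (A i) + e%:num%:E.
  by apply/lee_addgt0Pr => _/posnumP[].
rewrite (le_trans _ (epsilon_trick _ _ _))//; last first.
  by move=> k; exact: lebesgue_outer_ge0.
pose P k F := box_cover (A k) F /\
  \sum_(j <oo) vol (F j) <= lebesgue_outer (A k) + (e%:num / (2 ^ k.+1)%:R)%:E.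
have [G PG] : {G : nat -> nat -> Rn * Rn & forall k, P k (G k)}.
  apply: (@choice _ _ P) => k; rewrite /P /lebesgue_outer.
  set S := (X in ereal_inf X); move infS : (ereal_inf S) => iS.
  case: iS infS => [r Sr|Soo|Soo].
  - have en1 : (0 < e%:num / (2 ^ k.+1)%:R)%R by [].
    have /(lb_ereal_inf_adherent en1) : ereal_inf S \is a fin_num by rewrite Sr.
    move=> [x [B AnB muBx] xS].
    by exists B; split => //; rewrite /vol muBx -Sr; exact/ltW.
  - by have := Aoo k; rewrite /lebesgue_outer Soo.
  - suff : lbound S 0 by move/le_ereal_inf_tmp; rewrite Soo.
    by move=> /= _ [B AnB <-]; apply: nneseries_ge0 => j _ _; exact: vol_ge0.
have volG_ge0 x : 0 <= (vol \o uncurry G) x by exact: vol_ge0.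
apply: (@le_trans _ _ (\esum_(i in setT) (vol \o uncurry G) i)).
  apply: ereal_inf_lbound => /=.
  have /card_esym/ppcard_eqP[f] := card_nat2.
  exists (uncurry G \o f).
    apply: (@subset_trans _ (\bigcup_k \bigcup_j box (G k j))) => [t [i _]|].
      by move=> /(PG i).1 -[j _ ?]; exists i => //; exists j.
    move=> t [i _ [j _ Bijt]]; exists (f^-1%FUN (i, j)) => //=.
    by rewrite invK ?inE.
  rewrite -(esum_pred_image (vol \o uncurry G) _ xpredT) ?[fun=> _]set_true//.
  by rewrite image_eq.
rewrite (_ : esum _ _ = \sum_(i <oo) \sum_(j <oo ) vol (G i j)); last first.
  pose J : nat -> set (nat * nat) := fun i => [set (i, j) | j in setT].
  rewrite (_ : setT = \bigcup_k J k); last first.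
    by rewrite predeqE => -[a b]; split => // _; exists a => //; exists b.
  rewrite esum_bigcupT /=; last 2 first.
    - apply/trivIsetP => i j _ _ ij.
      rewrite predeqE => -[k m] /=; split => //= -[] [_] _ [<-{k} _].
      by move=> [m' _] [] /esym/eqP; rewrite (negbTE ij).
    - by move=> /= [k m]; exact: vol_ge0.
  rewrite -(image_id [set: nat]) -fun_true esum_pred_image//; last first.
    by move=> k _; exact: esum_ge0.
  apply: eq_eseriesr => /= j _.
  rewrite -(esum_pred_image (vol \o uncurry G) (pair j) predT)//=; last first.
    by move=> ? ? _ _; exact: (@can_inj _ _ _ snd).
  by congr esum; rewrite predeqE => -[a b]; split; move=> [i _ <-]; exists i.
apply: lee_lim.
- apply: is_cvg_nneseries => k *.
  by apply: nneseries_ge0 => m *; exact: vol_ge0.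
- apply: is_cvg_nneseries => k *; apply: adde_ge0 => //.
  exact: lebesgue_outer_ge0.
- by near=> k; apply: lee_sum => i _; exact: (PG i).2.
Unshelve. all: by end_near. Qed.

HB.instance Definition _ := isOuterMeasure.Build R Rn lebesgue_outer
  lebesgue_outer0 lebesgue_outer_ge0 le_lebesgue_outer
  lebesgue_outer_sigma_subadditive.

Definition lebesgue_outer_measure : {outer_measure set Rn -> \bar R} :=
  lebesgue_outer.

End lebesgue_outer_measure.

(** [lebesgue_space R n] is R^n.+1 itself, carrying the sigma-algebra of its
Lebesgue-measurable sets. *)
Definition lebesgue_space (R : realType) (n : nat) : measurableType _ :=
  caratheodory_type (@lebesgue_outer_measure R n).

Definition lebesgue (R : realType) (n : nat) :
    {measure set (lebesgue_space R n) -> \bar R} :=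
  (@lebesgue_outer_measure R n :
    set (caratheodory_type (@lebesgue_outer_measure R n)) -> \bar R).
Arguments lebesgue {R n}.

Section function_spaces.
Context (R : realType) (n : nat).
Local Notation Rn := 'rV[R]_n.+1.
Local Notation measurableRn := (lebesgue_space R n).

Definition ae (P : Rn -> Prop) : Prop :=
  \forall x \ae (@lebesgue R n), P x.

Definition integral_on (D : set Rn) (f : Rn -> R) : R :=
  Rintegral (@lebesgue R n) D f.

Definition average (V : set Rn) (f : Rn -> R) : R :=
  (fine (@lebesgue R n V))^-1 * integral_on V f.

(** The lattice generated by the rows of [A]. *)
Definition lattice_point (A : 'M[R]_n.+1) (z : 'rV[int]_n.+1) : Rn :=
  map_mx intr z *m A.

(** The translates of [V] along the lattice cover R^n.+1 and do not overlap;
both are up to null sets, so that [V] may be open, closed or half-open. *)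
Definition unit_cell (A : 'M[R]_n.+1) (V : set Rn) : Prop :=
  [/\ A \in unitmx,
      measurable (V : set measurableRn),
      ae (fun x => exists z, V (x - lattice_point A z)) &
      forall z, z != 0 ->
        @lebesgue R n (V `&` [set x | V (x - lattice_point A z)]) = 0%E].

Definition periodic (T : Type) (A : 'M[R]_n.+1) (f : Rn -> T) : Prop :=
  forall z, ae (fun x => f (x + lattice_point A z) = f x).

Definition L2loc (f : Rn -> R) : Prop :=
  measurable_fun [set: measurableRn] (f : measurableRn -> R) /\
  forall K : set Rn, compact K ->
    (@lebesgue R n).-integrable K (fun x => (f x ^+ 2)%:E).

Definition L2per (A : 'M[R]_n.+1) (f : Rn -> R) : Prop :=
  periodic A f /\ L2loc f.

Definition partial (i : 'I_n.+1) (f : Rn -> R) : Rn -> R :=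
  fun x => 'D_(delta_mx ord0 i) f x.

Definition iter_partial (s : seq 'I_n.+1) (f : Rn -> R) : Rn -> R :=
  foldr partial f s.

Definition smooth (f : Rn -> R) : Prop := forall s,
  continuous (iter_partial s f) /\
  forall x i, derivable (iter_partial s f) x (delta_mx ord0 i).

Definition test_function (phi : Rn -> R) : Prop :=
  smooth phi /\ compact (closure [set x | phi x != 0]).

Definition weak_partial (i : 'I_n.+1) (f g : Rn -> R) : Prop :=
  forall phi, test_function phi ->
    integral_on setT (fun x => f x * partial i phi x) =
    - integral_on setT (fun x => g x * phi x).

Definition H1loc (f : Rn -> R) : Prop :=
  L2loc f /\ forall i, exists2 g, L2loc g & weak_partial i f g.

Definition H1per (A : 'M[R]_n.+1) (f : Rn -> R) : Prop :=
  periodic A f /\ H1loc f.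

End function_spaces.

Section tensors.
Context (R : realType) (d : nat).

Definition tensor4 : Type := 'I_d -> 'I_d -> 'I_d -> 'I_d -> R.

Definition tensor_apply (T : tensor4) (e : 'M[R]_d) : 'M[R]_d :=
  \matrix_(i, j) \sum_k \sum_l T i j k l * e k l.

Definition ddot (s e : 'M[R]_d) : R := \sum_i \sum_j s i j * e i j.

Definition sym_mx (e : 'M[R]_d) : Prop := e^T = e.

Definition tensor_symmetric (T : tensor4) : Prop := forall i j k l,
  [/\ T i j k l = T k l i j, T i j k l = T j i k l & T i j k l = T i j l k].

Definition tensor_posdef (T : tensor4) : Prop :=
  forall e, sym_mx e -> e != 0 -> 0 < ddot (tensor_apply T e) e.

(** Inverse on symmetric matrices of the linear map given by [T]; this is
meaningful when [T] is invertible there. *)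
Definition tensor_inv (T : tensor4) (s : 'M[R]_d) : 'M[R]_d :=
  xget 0 [set e | sym_mx e /\ tensor_apply T e = s].

End tensors.

Section fields.
Context (R : realType) (n : nat).
Local Notation Rn := 'rV[R]_n.+1.
Local Notation field := (Rn -> 'M[R]_n.+1).

(** Fields are represented by functions; equality in the function spaces is
equality almost everywhere. *)
Definition field_eq (f g : field) : Prop := ae (fun x => f x = g x).

(** The common underlying space of the strain and of the stress fields. *)
Definition tensor_fields (A : 'M[R]_n.+1) : set field :=
  [set f | ae (fun x => sym_mx (f x)) /\
           forall i j, L2per A (fun x => f x i j)].

Definition strain_dot (V : set Rn) (L0 : tensor4 R n.+1) (e f : field) : R :=
  average V (fun x => ddot (tensor_apply L0 (e x)) (f x)).

Definition stress_dot (V : set Rn) (L0 : tensor4 R n.+1) (s t : field) : R :=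
  average V (fun x => ddot (s x) (tensor_inv L0 (t x))).

Definition dot_norm (dot : field -> field -> R) (f : field) : R :=
  Num.sqrt (dot f f).

Definition uniform_fields (A : 'M[R]_n.+1) : set field :=
  [set f | tensor_fields A f /\ exists E, field_eq f (cst E)].

(** [Dw] is the weak gradient: [Dw x i j] is the derivative of the i-th
component of [w] along the j-th coordinate. *)
Definition compatible_strains (A : 'M[R]_n.+1) : set field :=
  [set f | tensor_fields A f /\
    exists w : 'I_n.+1 -> Rn -> R, exists Dw : field,
    [/\ forall i, H1per A (w i),
        forall i j, L2loc (fun x => Dw x i j) /\
                    weak_partial j (w i) (fun x => Dw x i j) &
        field_eq f (fun x => 2^-1 *: (Dw x + (Dw x)^T))]].

(** [div s = 0] on R^n.+1 in the sense of distributions. *)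
Definition equilibrated_stresses (A : 'M[R]_n.+1) : set field :=
  [set s | tensor_fields A s /\
    forall phi, test_function phi -> forall i,
      integral_on setT (fun x => \sum_j s x i j * partial j phi x) = 0].

Definition orth (H : set field) (dot : field -> field -> R) (M : set field) :
    set field :=
  [set f | H f /\ forall g, M g -> dot f g = 0].

Definition orth_projector (H : set field) (dot : field -> field -> R)
    (M : set field) (P : field -> field) : Prop :=
  forall f, H f -> M (P f) /\ orth H dot M (f - P f).

Definition is_gradient (H : set field) (dot : field -> field -> R)
    (J : field -> R) (f g : field) : Prop :=
  H g /\ forall h, H h -> t^-1 * (J (f + t *: h) - J f) @[t --> 0^'] --> dot g h.

(** [g] is the gradient of [J] at [f]: it exists, and is [g] as an element of
[H]. *)
Definition gradient_eq (H : set field) (dot : field -> field -> R)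
    (J : field -> R) (f g : field) : Prop :=
  is_gradient H dot J f g /\
  forall g', is_gradient H dot J f g' -> field_eq g' g.

Definition elasticity_field (A : 'M[R]_n.+1) (V : set Rn)
    (L : Rn -> tensor4 R n.+1) : Prop :=
  [/\ forall i j k l, measurable_fun [set: lebesgue_space R n]
                        ((fun x => L x i j k l) : lebesgue_space R n -> R),
      periodic A L,
      ae (fun x => tensor_symmetric (L x)),
      forall i j k l, exists M, ae (fun x => V x -> `|L x i j k l| <= M) &
      exists2 m, 0 < m & ae (fun x => forall e, sym_mx e ->
        m * ddot e e <= ddot (tensor_apply (L x) e) e)].

Definition field_apply (L : Rn -> tensor4 R n.+1) (f : field) : field :=
  fun x => tensor_apply (L x) (f x).

Definition field_inv (L : Rn -> tensor4 R n.+1) (f : field) : field :=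
  fun x => tensor_inv (L x) (f x).

Definition residual (L : Rn -> tensor4 R n.+1) (x : Rn) (tau eta : field) : R :=
  let s := tau - field_apply L eta in 2^-1 * ddot (s x) (field_inv L s x).

Definition objective (V : set Rn) (L0 : tensor4 R n.+1)
    (L : Rn -> tensor4 R n.+1) (PE PSorth : field -> field) (ebar : field)
    (tau eta : field) : R :=
  2^-1 * dot_norm (strain_dot V L0) (eta - PE eta - ebar) ^+ 2 +
  average V (fun x => residual L x tau eta) +
  2^-1 * dot_norm (stress_dot V L0) (PSorth tau) ^+ 2.

End fields.

(* Main.v *)
From HB Require Import structures.
From mathcomp Require Import all_boot all_order all_algebra.
From mathcomp Require Import all_classical all_reals all_analysis.
From mathcomp Require Import measurable_realfun.
From mathcomp Require Import ring lra zify.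
Require Import Defs.
Set Implicit Arguments.
Unset Strict Implicit.
Unset Printing Implicit Defensive.
Import Order.TTheory GRing.Theory Num.Theory.
Import numFieldNormedType.Exports.
Local Open Scope classical_set_scope.
Local Open Scope ring_scope.

(** Everything reduces to quadratic forms. For a field [K] of moduli, that is
a bounded measurable periodic field of symmetric definite tensors, put
[energy V K f g] for the cell average of [K f : g]. Both energetic products
are of this form, with [K = L0] for strains and [K = L0^-1] for stresses, and
so is the residual term of the objective, with [K = L^-1]. Such a form is
symmetric and bilinear on the space of tensor fields, and it is definite up to
null sets ([energy_eq0]). Along a line [f + t h] the objective is therefore a
polynomial of degree 2 in [t]; its linear coefficient, rewritten as the
energetic product of a fixed field with [h], gives the gradient
([gradient_eq_quadratic]), and definiteness makes the gradient unique.

Identifying the linear coefficient takes three facts. First, inverting [L] or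
[L0] pointwise cancels against applying it ([field_inv_apply],
[energy_inv]); measurability of [L^-1] comes from Cramer's rule
([lmeasurable_inv_tensor]), its boundedness from coercivity
([inv_tensor_le]). Second, an orthogonal projector is linear up to null sets
([projector_linear]) and self-adjoint. Third, the term
[(eta - P eta - ebar, P h)] vanishes: its first part by orthogonality, and the
product of the uniform field [ebar] with the compatible strain [P h] because
compatible strains average to zero ([pairing_cst_compatible]).

The last fact carries the analysis. For a periodic function [p] and a smooth
compactly supported [bump] whose lattice translates add up to 1, the integral
of [p * bump] over the whole space is the integral of [p] over a cell, while
the integral of [p] against a derivative of [bump] vanishes. Applied to the
displacement and to its weak gradient, this shows that the gradient has zero
average. The bump is a product of one-dimensional humps
[step t - step (t - 1)] in lattice coordinates; both claims follow from
[integral_periodic_telescope], which says that a product with one telescoping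
factor [u t - u (t - 1)] is orthogonal to all periodic functions. Humps replace
the indicator of the unit parallelepiped one coordinate at a time.

The measure theory underneath is that of the Caratheodory extension of box
volumes: it is invariant under translations and makes half-spaces, hence open
and compact sets, measurable. As the unit cell is any measurable set that
tiles up to null sets, possibly unbounded, integrals over it are transported
to the bounded parallelepiped spanned by the lattice basis
([tiling_integral]). *)

(** * Translation invariance and measurability for the Lebesgue measure *)

Section lebesgue_translation.
Context (R : realType) (n : nat).
Local Notation Rn := 'rV[R]_n.+1.
Local Notation LRn := (lebesgue_space R n).
Local Notation mu := (@lebesgue R n).
Implicit Types (X : set Rn) (y : Rn).

Lemma le_lebesgue_outer_shift X y :
  (lebesgue_outer [set x | X (x + y)%R] <= lebesgue_outer X)%E.
Proof.
apply: le_ereal_inf_tmp => _ [F XF <-].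
apply: ereal_inf_lbound; exists (fun k => ((F k).1 - y, (F k).2 - y)).
  move=> x /= /XF[k _ Fk]; exists k => // i /=.
  by have := Fk i; rewrite !mxE; lra.
apply: eq_eseriesr => k _; congr EFin; apply: eq_bigr => i _ /=.
by rewrite !mxE; congr Num.max; lra.
Qed.

Lemma lebesgue_outer_shift X y :
  lebesgue_outer [set x | X (x + y)] = lebesgue_outer X.
Proof.
apply/eqP; rewrite eq_le le_lebesgue_outer_shift/=.
have := le_lebesgue_outer_shift [set x | X (x + y)] (- y).
congr (_ <= _)%E; congr lebesgue_outer.
by apply/funext => x /=; rewrite addrNK.
Qed.

Lemma measurable_shift X y : measurable (X : set LRn) ->
  measurable ([set x | X (x + y)] : set LRn).
Proof.
move=> mX; apply: le_caratheodory_measurable => Y.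
rewrite -[X in (_ <= X)%E](lebesgue_outer_shift Y (- y)).
have := mX [set x | Y (x - y)]; rewrite /= => ->.
rewrite /lebesgue_outer_measure /= -(lebesgue_outer_shift (_ `&` X) y).
rewrite -(lebesgue_outer_shift (_ `&` ~` X) y).
have e Z : [set x | ([set x | Y (x - y)] `&` Z) (x + y)] = Y `&` [set x | Z (x + y)].
  by apply/funext => x /=; rewrite addrK.
by rewrite !e; exact: lexx.
Qed.

Lemma lebesgue_shift X y : mu [set x | X (x + y)] = mu X.
Proof. exact: lebesgue_outer_shift. Qed.

(** Stated between copies of the Lebesgue space so that the image of the measure
under a translation can be formed. *)
Lemma measurable_fun_shift y :
  measurable_fun [set: LRn] ((fun x => x + y) : LRn -> LRn).
Proof. by move=> _ B mB; rewrite setTI; exact: measurable_shift. Qed.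

Lemma ae_shift (P : Rn -> Prop) y : ae P -> ae (fun x => P (x + y)).
Proof.
move=> [N [mN N0 PN]]; exists [set x | N (x + y)]; split.
- exact: measurable_shift.
- by rewrite lebesgue_shift.
- by move=> x /= Px; apply: PN.
Qed.

#[global] Instance ae_filter : Filter (@ae R n) := ae_filter_ringOfSetsType mu.

Local Open Scope ereal_scope.

Lemma ge0_integral_shift (f : Rn -> \bar R) y :
  measurable_fun [set: LRn] (f : LRn -> \bar R) -> (forall x, 0 <= f x) ->
  \int[mu]_x f (x + y)%R = \int[mu]_x f x.
Proof.
move=> mf f0.
have := @ge0_integral_pushforward _ _ _ _ R _ (measurable_fun_shift y)
   mu setT f measurableT mf (fun _ _ => f0 _).
rewrite preimage_setT => <-.
unshelve refine (eq_measure_integral mu _); first exact: measurable_fun_shift.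
by move=> B mB _; exact: (lebesgue_shift B y).
Qed.

Lemma integral_shift (f : Rn -> \bar R) y :
  measurable_fun [set: LRn] (f : LRn -> \bar R) ->
  \int[mu]_x f (x + y)%R = \int[mu]_x f x.
Proof.
move=> mf; rewrite integralE [RHS]integralE; congr (_ - _).
  rewrite -(ge0_integral_shift y (measurable_funepos mf) (funepos_ge0 f)).
  by apply: eq_integral => x _; rewrite !funeposE.
rewrite -(ge0_integral_shift y (measurable_funeneg mf) (funeneg_ge0 f)).
by apply: eq_integral => x _; rewrite !funenegE.
Qed.

Local Close Scope ereal_scope.

(** Cutting the boxes of a covering along the hyperplane [x_i = c] does not
change their total volume. *)
Lemma measurable_halfspace (i : 'I_n.+1) (c : R) :
  measurable ([set x : Rn | x ord0 i < c] : set LRn).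
Proof.
pose cut (lo : bool) (ab : Rn * Rn) : Rn * Rn :=
  if lo then (ab.1, \row_j if j == i then Num.min (ab.2 ord0 j) c else ab.2 ord0 j)
  else (\row_j if j == i then Num.max (ab.1 ord0 j) c else ab.1 ord0 j, ab.2).
have vol_cut ab : box_volume (cut true ab) + box_volume (cut false ab) = box_volume ab.
  rewrite /box_volume /cut /= (bigD1 i)//= [X in _ + X = _](bigD1 i)//= [RHS](bigD1 i)//= !mxE eqxx.
  rewrite (eq_bigr (fun j => Num.max 0 (ab.2 ord0 j - ab.1 ord0 j))); last first.
    by move=> j ji; rewrite !mxE (negbTE ji).
  rewrite [X in _ + _ * X](eq_bigr (fun j => Num.max 0 (ab.2 ord0 j - ab.1 ord0 j))); last first.
    by move=> j ji; rewrite !mxE (negbTE ji).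
  rewrite -mulrDl; congr (_ * _).
  move: (ab.2 ord0 i) (ab.1 ord0 i) => u v.
  by rewrite !maxEle minEle; case: (leP u c); case: (leP v c) => h2 h1;
    do ?case: ifPn; rewrite -?ltNge; lra.
have vol_ge0 ab : (0 <= (@box_volume R n ab)%:E)%E.
  by rewrite lee_fin; apply: prodr_ge0 => j _; rewrite le_max lexx.
apply: le_caratheodory_measurable => X.
apply: le_ereal_inf_tmp => _ [F XF <-].
apply: (@le_trans _ _ (\sum_(k <oo) (box_volume (cut true (F k)))%:E +
  \sum_(k <oo) (box_volume (cut false (F k)))%:E)%E); last first.
  rewrite -nneseriesD//; apply: lee_nneseries => // k _.
    by rewrite adde_ge0.
  by rewrite -EFinD vol_cut.
apply: leeD; apply: ereal_inf_lbound.
  exists (fun k => cut true (F k)) => // x [/XF[k _ Fk] xc]; exists k => // j.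
  have /= := Fk j; rewrite !mxE; case: eqP => [->|//].
  by rewrite lt_min => /andP[-> ->].
exists (fun k => cut false (F k)) => // x [/XF[k _ Fk] /negP xc]; exists k => // j.
have /= := Fk j; rewrite !mxE; case: eqP => [->|//].
by rewrite ge_max => /andP[-> ->]; rewrite andbT /= leNgt.
Qed.

Lemma measurable_coord (i : 'I_n.+1) :
  measurable_fun [set: LRn] ((fun x : Rn => x ord0 i) : LRn -> R).
Proof.
apply: (measurability _ (RGenInftyO.measurableE R)) => // _ [_ [c ->] <-].
rewrite setTI; apply: (eq_ind _ (fun A : set LRn => measurable A) (measurable_halfspace i c)).
by apply/seteqP; split => x /=; rewrite in_itv.
Qed.

Lemma measurable_linear (B : 'M[R]_n.+1) k :
  measurable_fun [set: LRn] ((fun x : Rn => (x *m B) ord0 k) : LRn -> R).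
Proof.
rewrite (_ : (fun _ => _) = fun x : LRn => \sum_j (x : Rn) ord0 j * B j k).
  apply: (@measurable_sum _ LRn) => j.
  exact: measurable_funM (measurable_coord j) (measurable_cst _).
by apply/funext => x; rewrite mxE.
Qed.

Lemma measurable_box ab : measurable (@box R n ab : set LRn).
Proof.
rewrite (_ : box ab = \big[setI/setT]_(i : 'I_n.+1)
    [set x : Rn | ab.1 ord0 i <= x ord0 i < ab.2 ord0 i]); last first.
  rewrite -(bigcap_seq (index_enum _)); apply/seteqP; split => x xab i.
    by move=> _; exact: xab.
  by apply: xab; rewrite /= mem_index_enum.
apply: (@bigsetI_measurable _ LRn) => i _.
rewrite (_ : mkset _ = setT `&` (fun x : Rn => x ord0 i) @^-1` `[ab.1 ord0 i, ab.2 ord0 i[%classic).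
  by apply: (measurable_coord i).
by rewrite setTI; apply/seteqP; split => x /=; rewrite in_itv.
Qed.

Lemma lebesgue_box ab : (mu (@box R n ab) < +oo)%E.
Proof.
apply: (@le_lt_trans _ _ (box_volume ab)%:E); last exact: ltry.
apply: ereal_inf_lbound; exists (fun k => if k == 0%N then ab else (0, 0)).
  by move=> x xab; exists 0%N.
rewrite (nneseries_split 0%N 1%N)//=.
- rewrite big_nat1/= eseries0 ?adde0// => k k1 _.
  rewrite ifF ?gtn_eqF//.
  by congr EFin; rewrite /box_volume big_ord_recl subrr maxxx mul0r.
- move=> k _ ; rewrite lee_fin; apply: prodr_ge0 => j _; by rewrite le_max lexx.
Qed.

(** An open set is the union of the countably many boxes with rational
vertices that it contains. *)
Lemma measurable_open (U : set Rn) : open U -> measurable (U : set LRn).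
Proof.
move=> oU.
pose rbox (ab : 'rV[rat]_n.+1 * 'rV[rat]_n.+1) : set Rn :=
  box (map_mx ratr ab.1, map_mx ratr ab.2).
rewrite (_ : U = \bigcup_(ab in [set ab | rbox ab `<=` U]) rbox ab); last first.
  apply/seteqP; split; last by move=> x [ab abU]; exact: abU.
  move=> x /[dup] Ux /(open_subball oU)[e /= e0 eU].
  have [e' [e'0 e'U]] : exists e', 0 < e' /\ ball x e' `<=` U.
    exists (e / 2); split; first by rewrite divr_gt0.
    by apply: (eU (e / 2)) => //=; rewrite ?divr_gt0// sub0r normrN ger0_norm ?ltr_pdivrMr//; lra.
  have Pa i : exists q : rat, x ord0 i - e' < ratr q <= x ord0 i.
    have := @rat_in_itvoo R (x ord0 i - e') (x ord0 i).
    case; first lra.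
    by move=> q; rewrite in_itv/= => /andP[q1 q2]; exists q; rewrite q1 ltW.
  have Pb i : exists q : rat, x ord0 i < ratr q < x ord0 i + e'.
    have := @rat_in_itvoo R (x ord0 i) (x ord0 i + e').
    case; first lra.
    by move=> q; rewrite in_itv/= => /andP[q1 q2]; exists q; rewrite q1.
  have [a Ha] := choice Pa; have [b Hb] := choice Pb.
  exists (\row_i a i, \row_i b i) => /=.
    move=> y yab; apply: e'U; split=> // i j; rewrite /ball/= (ord1 i).
    have := yab j; rewrite /= !mxE => y2.
    have := Ha j; have := Hb j; rewrite /= ltr_norml; lra.
  by move=> i /=; rewrite !mxE; have := Ha i; have := Hb i; lra.
rewrite bigcup_mkcond; apply: countable_bigcupT_measurable => // ab.
by case: ifPn => // _; exact: measurable_box.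
Qed.

Lemma compact_closed_Rn (K : set Rn) : compact K -> closed K.
Proof. by apply: compact_closed; exact: norm_hausdorff. Qed.

Lemma measurable_compact (K : set Rn) : compact K -> measurable (K : set LRn).
Proof.
move=> /compact_closed_Rn cK; rewrite -(setCK K).
by apply: measurableC; apply: measurable_open; exact: closed_openC.
Qed.

Definition cube (M : R) : set Rn := [set x | forall i, `|x ord0 i| <= M].

Lemma compact_cube M : compact (cube M).
Proof.
have := @rV_compact R n.+1 (fun=> `[- M, M]%classic) (fun=> @segment_compact _ _ _).
congr compact; apply/seteqP; split => x xM i; have := xM i; rewrite /= in_itv/= ler_norml //.
Qed.

Lemma lebesgue_cube M : (mu (cube M) < +oo)%E.
Proof.
apply: le_lt_trans (lebesgue_box (const_mx (- M - 1), const_mx (M + 1))).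
apply: le_outer_measure => x xM i; rewrite !mxE/=.
by have := xM i; rewrite ler_norml; lra.
Qed.

Lemma coord_le_norm (x : Rn) i : `|x ord0 i| <= `|x|.
Proof.
by rewrite [leRHS]/Num.norm /= mx_normrE; apply: (le_bigmax _ _ (ord0, i)).
Qed.

Lemma compact_sub_cube (K : set Rn) : compact K -> exists M, K `<=` cube M.
Proof.
move=> /compact_bounded[M [_ KM]]; exists (M + 1) => x Kx i.
by apply: le_trans (KM (M + 1) _ x Kx); [exact: coord_le_norm|lra].
Qed.

End lebesgue_translation.
Arguments cube {R n}.
Arguments compact_cube {R n} M.

(** * Locally square-integrable functions *)

Section L2loc_closure.
Context (R : realType) (n : nat).
Local Notation Rn := 'rV[R]_n.+1.
Local Notation LRn := (lebesgue_space R n).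
Local Notation mu := (@lebesgue R n).
Local Notation lmeasurable f := (measurable_fun [set: LRn] (f : LRn -> R)).
Implicit Types (f g h : Rn -> R) (K : set Rn).

Lemma ae_forall_count (T : countType) (P : T -> Rn -> Prop) :
  (forall z, ae (P z)) -> ae (fun x => forall z, P z x).
Proof.
move=> aeP.
have : ae (fun x => forall k : nat, if unpickle k is Some z then P z x else True).
  apply: ae_foralln => k; case: (unpickle k) => [z|]; [exact: aeP|exact: aeW].
by apply: filterS => x Px z; have := Px (pickle z); rewrite pickleK.
Qed.

Lemma ae_lmeasurable f g : ae (fun x => f x = g x) ->
  lmeasurable f -> lmeasurable g.
Proof.
move=> fg /measurable_EFinP mf; apply/measurable_EFinP.
apply: (ae_measurable_fun (@measure_is_complete_caratheodory _ _ _) _ mf).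
by apply: filterS fg => x /= ->.
Qed.

Lemma L2loc_cube f : lmeasurable f ->
  (forall M, (\int[mu]_(x in cube M) (f x ^+ 2)%:E < +oo)%E) -> L2loc f.
Proof.
move=> mf fM; split => // K cK.
have [M KM] := compact_sub_cube cK.
apply: (@integrableS _ LRn _ mu (cube M)) => //.
- exact/measurable_compact/compact_cube.
- exact: measurable_compact.
- apply/integrableP; split.
    apply: measurable_funTS; apply/measurable_EFinP.
    exact: measurable_funX.
  by under eq_integral do rewrite gee0_abs ?lee_fin ?sqr_ge0//; exact: fM.
Qed.

(** The one domination principle from which the closure properties of [L2loc]
below are derived. *)
Lemma L2loc_le C f g h : L2loc f -> L2loc g -> lmeasurable h ->
  ae (fun x => h x ^+ 2 <= C * (f x ^+ 2 + g x ^+ 2)) -> L2loc h.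
Proof.
move=> [mf intf] [mg intg] mh hfg; apply: L2loc_cube => // M.
have mM : measurable (cube M : set LRn) by exact/measurable_compact/compact_cube.
have ifg : mu.-integrable (cube M) (fun x => (C * (f x ^+ 2 + g x ^+ 2))%:E).
  have := @integrableZl _ LRn R mu _ mM C _ (integrableD mM (intf _ (compact_cube M)) (intg _ (compact_cube M))).
  by apply: eq_integrable.
apply: (@le_lt_trans _ _ (\int[mu]_(x in cube M) `|(C * (f x ^+ 2 + g x ^+ 2))%:E|)%E); last first.
  by case/integrableP : ifg.
apply: ae_ge0_le_integral.
- exact: mM.
- by move=> x _; rewrite lee_fin sqr_ge0.
- by apply/measurable_EFinP; apply: measurable_funTS; exact: measurable_funX.
- by move=> x _; exact: abse_ge0.
- by apply/measurableT_comp; [exact: abse_measurable|case/integrableP: ifg].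
- by apply: filterS hfg => x hx _; rewrite lee_fin (le_trans hx)// ler_norm.
Qed.

Lemma L2locD f g : L2loc f -> L2loc g -> L2loc (fun x => f x + g x).
Proof.
move=> Lf Lg; apply: (L2loc_le (C := 2) Lf Lg).
  by apply: measurable_funD; [case: Lf|case: Lg].
by apply: aeW => x; have := sqr_ge0 (f x - g x); lra.
Qed.

Lemma L2locM C k f : lmeasurable k -> ae (fun x => `|k x| <= C) -> L2loc f ->
  L2loc (fun x => k x * f x).
Proof.
move=> mk kC Lf; apply: (L2loc_le (C := C ^+ 2) Lf Lf).
  by apply: measurable_funM => //; case: Lf.
apply: filterS kC => x kC; rewrite exprMn ler_pM ?sqr_ge0//; last first.
  by rewrite lerDl sqr_ge0.
by rewrite -(real_normK (num_real (k x))) lerXn2r ?nnegrE// (le_trans _ kC).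
Qed.

Lemma L2loc_cst (c : R) : L2loc (cst c : Rn -> R).
Proof.
apply: L2loc_cube => [|M]; first exact: measurable_cst.
have mM : measurable (cube M : set LRn) by exact/measurable_compact/compact_cube.
rewrite (integral_cst mu mM (c ^+ 2)%:E) lte_mul_pinfty ?lee_fin ?sqr_ge0//.
exact: lebesgue_cube.
Qed.

Lemma L2loc_ae f g : ae (fun x => f x = g x) -> L2loc f -> L2loc g.
Proof.
move=> fg Lf; apply: (L2loc_le (C := 1) Lf Lf).
  by apply: ae_lmeasurable fg _; case: Lf.
by apply: filterS fg => x <-; rewrite mul1r lerDl sqr_ge0.
Qed.

Lemma L2loc_sum (I : Type) (s : seq I) (F : I -> Rn -> R) :
  (forall i, L2loc (F i)) -> L2loc (fun x => \sum_(i <- s) F i x).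
Proof.
move=> LF; elim: s => [|i s IH].
  by apply: L2loc_ae (L2loc_cst 0); apply: aeW => x; rewrite big_nil.
apply: L2loc_ae (L2locD (LF i) IH).
by apply: aeW => x; rewrite big_cons.
Qed.

End L2loc_closure.

(** * Fundamental domains of a lattice *)

Section tilings.
Context (R : realType) (n : nat) (A : 'M[R]_n.+1).
Hypothesis uA : A \in unitmx.
Local Notation Rn := 'rV[R]_n.+1.
Local Notation LRn := (lebesgue_space R n).
Local Notation mu := (@lebesgue R n).
Local Notation lp := (lattice_point A).
Implicit Types (V W : set Rn).

Lemma lattice_pointD y z : lp (y + z) = lp y + lp z.
Proof. by rewrite /lattice_point map_mxD mulmxDl. Qed.

Lemma lattice_point0 : lp 0 = 0.
Proof. by rewrite /lattice_point map_mx0 mul0mx. Qed.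

Lemma lattice_pointN z : lp (- z) = - lp z.
Proof. by apply/eqP; rewrite -addr_eq0 -lattice_pointD addNr lattice_point0. Qed.

(** The overlaps are empty and not only null as in [unit_cell], so that the
translates form a disjoint family, as countable additivity requires. *)
Definition tiling W : Prop :=
  [/\ measurable (W : set LRn),
      forall x z, W x -> W (x - lp z) -> z = 0 &
      ae (fun x => exists z, W (x - lp z))].

Definition parallelepiped : set Rn :=
  [set x | forall i, 0 <= (x *m invmx A) ord0 i < 1].

Lemma lattice_coord z i : (lp z *m invmx A) ord0 i = (z ord0 i)%:~R.
Proof. by rewrite /lattice_point mulmxK// mxE. Qed.

Lemma lattice_coordB x z i :
  ((x - lp z) *m invmx A) ord0 i = (x *m invmx A) ord0 i - (z ord0 i)%:~R.
Proof. by rewrite mulmxBl mxE [X in _ + X]mxE lattice_coord. Qed.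

Lemma measurable_parallelepiped : measurable (parallelepiped : set LRn).
Proof.
rewrite (_ : parallelepiped = \big[setI/setT]_(i : 'I_n.+1)
    [set x : Rn | 0 <= (x *m invmx A) ord0 i < 1]); last first.
  rewrite -(bigcap_seq (index_enum _)); apply/seteqP; split => x xab i.
    by move=> _; exact: xab.
  by apply: xab; rewrite /= mem_index_enum.
apply: (@bigsetI_measurable _ LRn) => i _.
rewrite (_ : mkset _ = setT `&` (fun x : Rn => (x *m invmx A) ord0 i) @^-1` `[0, 1[%classic).
  by apply: (measurable_linear (invmx A) i).
by rewrite setTI; apply/seteqP; split => x /=; rewrite in_itv.
Qed.

Lemma tiling_parallelepiped : tiling parallelepiped.
Proof.
split; first exact: measurable_parallelepiped.
- move=> x z Qx Qxz; apply/rowP => i; rewrite mxE.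
  have := Qx i; have := Qxz i; rewrite lattice_coordB.
  set c := (x *m _) _ _ => c1 c2.
  have /andP[] : ((-1)%:~R < (z ord0 i)%:~R :> R) && ((z ord0 i)%:~R < 1%:~R :> R).
    by rewrite mulrN1z mulr1z; lra.
  by rewrite !ltr_int; move: (z ord0 i : int) => k; lia.
- apply: aeW => x; exists (\row_i Num.floor ((x *m invmx A) ord0 i)) => i.
  rewrite lattice_coordB mxE.
  set c := (x *m _) _ _; have := floor_itv (c : R).
  by rewrite intrD => /andP[c1 c2]; rewrite subr_ge0 c1/= ltrBlDl.
Qed.

Lemma parallelepiped_sub_cube : exists M, parallelepiped `<=` cube M.
Proof.
exists (\sum_j \sum_k `|A k j|) => x Qx i.
have -> : x ord0 i = (x *m invmx A *m A) ord0 i by rewrite mulmxKV.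
rewrite mxE.
apply: le_trans (ler_norm_sum _ _ _) _.
apply: (@le_trans _ _ (\sum_k `|A k i|)).
  apply: ler_sum => k _; rewrite normrM -[leRHS]mul1r ler_wpM2r//.
  by have := Qx k; rewrite ler_norml; lra.
rewrite [leRHS](bigD1 i)//= lerDl.
by apply: sumr_ge0 => j _; exact: sumr_ge0.
Qed.

(** Removing from the cell its null overlaps with the countably many other
translates costs only a null set. *)
Lemma unit_cell_tiling V : unit_cell A V ->
  exists2 W, tiling W & ae (fun x => V x = W x).
Proof.
move=> [_ mV cV dV].
pose N : set Rn := [set x | exists2 z, z != 0 & V x /\ V (x - lp z)].
have nN : ae (fun x => ~ N x).
  have : ae (fun x => forall z, ~ (z != 0 /\ (V x /\ V (x - lp z)))).
    apply: ae_forall_count => z; have [->|z0] := eqVneq z 0.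
      by apply: aeW => x [].
    exists (V `&` [set x | V (x - lp z)]); split.
    - apply: (@measurableI _ LRn) => //; exact: (measurable_shift (- lp z) mV).
    - exact: dV.
    - by move=> x /= /contrapT[].
  by apply: filterS => x Nx [z z0 Vz]; apply: (Nx z).
have mN : measurable (N : set LRn).
  apply: measure_is_complete_caratheodory.
  by apply: negligibleS nN => x Nx /=; apply.
have VW : ae (fun x => V x = (V `\` N) x).
  by apply: filterS nN => x Nx; apply/propext; split => [|[]].
exists (V `\` N) => //; split.
- exact: (@measurableD _ LRn).
- move=> x z [Vx Nx] [Vz _]; apply: contrapT => /eqP z0; apply: Nx.
  by exists z.
- have : ae (fun x => forall z, V (x - lp z) = (V `\` N) (x - lp z)).
    by apply: ae_forall_count => z; exact: (ae_shift (- lp z) VW).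
  by apply: filterS2 cV => x [z Vz] /(_ z) e; exists z; rewrite -e.
Qed.

Local Open Scope ereal_scope.

Lemma ge0_ae_eq_set_integral V W (f : Rn -> \bar R) :
  measurable (V : set LRn) -> measurable (W : set LRn) ->
  measurable_fun [set: LRn] (f : LRn -> \bar R) -> (forall x, 0 <= f x) ->
  ae (fun x => V x = W x) -> \int[mu]_(x in V) f x = \int[mu]_(x in W) f x.
Proof.
move=> mV mW mf f0 VW; rewrite integral_mkcond [RHS]integral_mkcond.
apply: ge0_ae_eq_integral.
- exact: measurableT.
- by apply/measurable_restrict => //; rewrite setTI; exact: measurable_funTS.
- by apply/measurable_restrict => //; rewrite setTI; exact: measurable_funTS.
- by move=> x _; apply: erestrict_ge0 => y _; exact: f0.
- by move=> x _; apply: erestrict_ge0 => y _; exact: f0.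
- by apply: filterS VW => x VWx _; rewrite !patchE; congr (if _ then _ else _);
  apply/idP/idP; rewrite !inE VWx.
Qed.

(** Cutting one tiling along the other and translating the pieces back
shows that any two fundamental domains carry the same integrals. *)
Lemma tiling_integral V W (f : Rn -> \bar R) : tiling V -> tiling W ->
  measurable_fun [set: LRn] (f : LRn -> \bar R) -> (forall x, 0 <= f x) ->
  periodic A f -> \int[mu]_(x in V) f x = \int[mu]_(x in W) f x.
Proof.
move=> [mV tV cV] [mW tW cW] mf f0 pf.
(* [cut true] slices [V] along the translates of [W]; translating its pieces
   back by the same lattice vectors yields the slices [cut false] of [W]. *)
pose cut (s : bool) (k : nat) : set LRn :=
  if pickle_inv k is Some z then
    if s then V `&` [set x | W (x - lp z)%R] else W `&` [set x | V (x + lp z)%R]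
  else set0.
have mcut s k : measurable (cut s k).
  rewrite /cut; case: pickle_inv => // z; case: s.
    by apply: (@measurableI _ LRn) => //; exact: (measurable_shift (- lp z)%R mW).
  by apply: (@measurableI _ LRn) => //; exact: (measurable_shift (lp z) mV).
have tcut s : trivIset setT (cut s).
  apply/trivIsetP => i j _ _ ij; apply/seteqP; split => // x; rewrite /cut.
  have := @pickle_invK 'rV[int]_n.+1 i; have := @pickle_invK 'rV[int]_n.+1 j.
  case: (pickle_inv j) => [z|] zj; last by move=> [_ []].
  case: (pickle_inv i) => [y|] yi; last by move=> [[]].
  have yz : y != z by apply: contra_neq ij => yz; rewrite -yi -zj yz.
  case: s => -[[P1 P2] [P3 P4]]; move/negP: yz; apply; rewrite -subr_eq0; apply/eqP.
    apply: (tW (x - lp z)%R) => //.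
    by rewrite lattice_pointD lattice_pointN opprB addrA addrNK.
  apply: (tV (x + lp y)%R) => //.
  by rewrite lattice_pointD lattice_pointN opprB addrA addrAC addrK.
have eV : ae (fun x => V x = (\bigcup_k cut true k) x).
  apply: filterS cW => x [z Wz]; apply/propext; split => [Vx|[k _]].
    by exists (pickle z) => //; rewrite /cut pickleK_inv.
  by rewrite /cut; case: pickle_inv => // y [].
have eW : ae (fun x => W x = (\bigcup_k cut false k) x).
  apply: filterS cV => x [z Vz]; apply/propext; split => [Wx|[k _]].
    by exists (pickle (- z)%R) => //; rewrite /cut pickleK_inv; split; rewrite /= ?lattice_pointN.
  by rewrite /cut; case: pickle_inv => // y [].
have mU s : measurable (\bigcup_k cut s k) by exact: bigcupT_measurable.
rewrite (ge0_ae_eq_set_integral mV (mU true) mf f0 eV).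
rewrite (ge0_ae_eq_set_integral mW (mU false) mf f0 eW).
rewrite !ge0_integral_bigcup//; try exact: measurable_funTS.
apply: eq_eseriesr => k _; have := mcut true k; have := mcut false k.
rewrite /cut; case: pickle_inv => [z|]; last by rewrite !integral_set0.
move=> m1 m2; rewrite integral_mkcond [RHS]integral_mkcond.
rewrite -(ge0_integral_shift (lp z)); last 2 first.
- by apply/measurable_restrict => //; rewrite setTI; exact: measurable_funTS.
- by move=> x; apply: erestrict_ge0 => y _; exact: f0.
apply: ge0_ae_eq_integral.
- exact: measurableT.
- apply: (measurableT_comp _ (measurable_fun_shift (lp z))).
  by apply/measurable_restrict => //; rewrite setTI; exact: measurable_funTS.
- by apply/measurable_restrict => //; rewrite setTI; exact: measurable_funTS.
- by move=> x _; apply: erestrict_ge0 => y _; exact: f0.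
- by move=> x _; apply: erestrict_ge0 => y _; exact: f0.
- apply: filterS (pf z) => x fx _; rewrite !patchE.
  have -> : (x + lp z \in V `&` [set x | W (x - lp z)%R])%R =
            (x \in W `&` [set x | V (x + lp z)%R]).
    by apply/idP/idP; rewrite !inE /= addrK => -[].
  by case: ifP.
Qed.

End tilings.

(** * Periodic functions on the unit cell *)

Section periodic_functions.
Context (R : realType) (n : nat) (A : 'M[R]_n.+1) (V : set 'rV[R]_n.+1).
Hypothesis cellV : unit_cell A V.
Local Notation Rn := 'rV[R]_n.+1.
Local Notation LRn := (lebesgue_space R n).
Local Notation mu := (@lebesgue R n).
Local Notation lp := (lattice_point A).
Local Notation lmeasurable f := (measurable_fun [set: LRn] (f : LRn -> R)).

Let uA : A \in unitmx. Proof. by case: cellV. Qed.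
Let mV : measurable (V : set LRn). Proof. by case: cellV. Qed.

Lemma periodic_comp (T U : Type) (h : T -> U) (f : Rn -> T) :
  periodic A f -> periodic A (h \o f).
Proof. by move=> pf z; apply: filterS (pf z) => x /= ->. Qed.

Lemma periodic_comp2 (T T' U : Type) (h : T -> T' -> U)
    (f : Rn -> T) (g : Rn -> T') :
  periodic A f -> periodic A g -> periodic A (fun x => h (f x) (g x)).
Proof. by move=> pf pg z; apply: filterS2 (pf z) (pg z) => x /= -> ->. Qed.

Lemma periodic_ae (T : Type) (f g : Rn -> T) :
  ae (fun x => f x = g x) -> periodic A f -> periodic A g.
Proof.
move=> fg pf z.
by apply: filterS3 fg (ae_shift (lp z) fg) (pf z) => x <- <-.
Qed.

(** Almost every point is a translate of a point of the cell, and the lattice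
is countable. *)
Lemma ae_unit_cell (P : Rn -> Prop) : periodic A P ->
  ae (fun x => V x -> P x) -> ae P.
Proof.
move=> pP aeP; have [_ _ cV _] := cellV.
have h1 := ae_forall_count (fun z => ae_shift (- lp z) aeP).
have h2 := ae_forall_count (fun z => pP (- z)).
apply: filterS3 cV h1 h2 => x [z Vz] /(_ z Vz) Pz /(_ z).
by rewrite lattice_pointN => <-.
Qed.

(** The unit cell may be unbounded; the parallelepiped is not, which turns local
integrability into integrability over the cell. *)
Lemma ge0_integral_unit_cell (f : Rn -> \bar R) :
  measurable_fun [set: LRn] (f : LRn -> \bar R) -> (forall x, 0 <= f x)%E ->
  periodic A f ->
  (\int[mu]_(x in V) f x = \int[mu]_(x in parallelepiped A) f x)%E.
Proof.
move=> mf f0 pf; have [W tW VW] := unit_cell_tiling cellV.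
have mW : measurable (W : set LRn) by case: tW.
rewrite (ge0_ae_eq_set_integral mV mW mf f0 VW).
exact: tiling_integral tW (tiling_parallelepiped uA) mf f0 pf.
Qed.

Lemma integral_unit_cell (g : Rn -> R) : lmeasurable g -> periodic A g ->
  integral_on V g = integral_on (parallelepiped A) g.
Proof.
move=> mg pg; have mEg : measurable_fun [set: LRn] (EFin \o g : LRn -> \bar R).
  exact/measurable_EFinP.
rewrite /integral_on /Rintegral integralE [in RHS]integralE.
congr (fine (_ - _)%E); apply: ge0_integral_unit_cell.
- exact: measurable_funepos.
- exact: funepos_ge0.
- by move=> z; apply: filterS (pg z) => x gx; rewrite !funeposE gx.
- exact: measurable_funeneg.
- exact: funeneg_ge0.
- by move=> z; apply: filterS (pg z) => x gx; rewrite !funenegE gx.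
Qed.

Lemma L2per_sqr_integrable (f : Rn -> R) : L2per A f ->
  mu.-integrable V (EFin \o (fun x => f x ^+ 2)).
Proof.
move=> [pf [mf intf]].
have mf2 : measurable_fun [set: LRn] (EFin \o (fun x => f x ^+ 2) : LRn -> \bar R).
  by apply/measurable_EFinP; exact: measurable_funX.
apply/integrableP; split; first exact: measurable_funTS.
under eq_integral do rewrite gee0_abs ?lee_fin ?sqr_ge0//.
have [M QM] := parallelepiped_sub_cube uA.
have mQ := measurable_parallelepiped A.
rewrite ge0_integral_unit_cell//; last 2 first.
- by move=> x; rewrite lee_fin sqr_ge0.
- exact: (periodic_comp (fun t => (t ^+ 2)%:E) pf).
have mM := measurable_compact (@compact_cube R n M).
apply: (@le_lt_trans _ _ (\int[mu]_(x in cube M) (f x ^+ 2)%:E)%E).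
  apply: ge0_subset_integral => //; first exact: measurable_funTS.
  by move=> x _; rewrite lee_fin sqr_ge0.
have /integrableP[_] := intf _ (compact_cube M).
by under eq_integral do rewrite gee0_abs ?lee_fin ?sqr_ge0//.
Qed.

Lemma L2per_mul_integrable (f g : Rn -> R) : L2per A f -> L2per A g ->
  mu.-integrable V (EFin \o (fun x => f x * g x)).
Proof.
move=> Lf Lg.
apply: (le_integrable mV _ _ (integrableD mV (L2per_sqr_integrable Lf) (L2per_sqr_integrable Lg))).
  by apply: measurable_funTS; apply/measurable_EFinP; apply: measurable_funM;
    [case: Lf => _ []|case: Lg => _ []].
move=> x _; rewrite /= lee_fin [leRHS]ger0_norm ?addr_ge0 ?sqr_ge0//.
rewrite ler_norml; have := sqr_ge0 (f x - g x); have := sqr_ge0 (f x + g x).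
by have := sqr_ge0 (f x); have := sqr_ge0 (g x); nra.
Qed.

End periodic_functions.

(** * Fourth-order tensors and their inverses *)

Section tensor_algebra.
Context (R : realType) (d : nat).
Local Notation M := 'M[R]_d.
Implicit Types (T : tensor4 R d) (e f s : M).

Lemma ddotC e f : ddot e f = ddot f e.
Proof. by apply: eq_bigr => i _; apply: eq_bigr => j _; rewrite mulrC. Qed.

Lemma ddotDl e f s : ddot (e + f) s = ddot e s + ddot f s.
Proof.
rewrite -big_split; apply: eq_bigr => i _; rewrite -big_split.
by apply: eq_bigr => j _; rewrite mxE mulrDl.
Qed.

Lemma ddotZl (a : R) e s : ddot (a *: e) s = a * ddot e s.
Proof.
rewrite mulr_sumr; apply: eq_bigr => i _; rewrite mulr_sumr.
by apply: eq_bigr => j _; rewrite mxE mulrA.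
Qed.

Lemma ddotDr e f s : ddot s (e + f) = ddot s e + ddot s f.
Proof. by rewrite ddotC ddotDl !(ddotC s). Qed.

Lemma ddotZr (a : R) e s : ddot s (a *: e) = a * ddot s e.
Proof. by rewrite ddotC ddotZl ddotC. Qed.

Lemma ddot0r e : ddot e 0 = 0.
Proof. by rewrite -(scale0r 0) ddotZr mul0r. Qed.

Lemma ddotT e f : ddot e^T f = ddot e f^T.
Proof.
rewrite /ddot exchange_big; apply: eq_bigr => i _; apply: eq_bigr => j _.
by rewrite !mxE.
Qed.

Lemma sqr_le_ddot e i j : e i j ^+ 2 <= ddot e e.
Proof.
rewrite /ddot (bigD1 i)//= (bigD1 j)//= -addrA lerDl.
by rewrite addr_ge0// sumr_ge0// => k _; rewrite ?sumr_ge0// => *; rewrite -expr2 sqr_ge0.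
Qed.

Lemma ddot_ge0 e : 0 <= ddot e e.
Proof. by do 2 (apply: sumr_ge0 => ? _); rewrite -expr2 sqr_ge0. Qed.

Lemma ddot_eq0 e : ddot e e = 0 -> e = 0.
Proof.
move=> e0; apply/matrixP => i j; rewrite mxE; apply/eqP.
by rewrite -sqrf_eq0 eq_le sqr_ge0 -e0 sqr_le_ddot.
Qed.

Lemma ddot_delta e p q : ddot e (delta_mx p q) = e p q.
Proof.
rewrite /ddot (bigD1 p)//= (bigD1 q)//= mxE !eqxx mulr1.
rewrite big1 => [|w wq]; last by rewrite mxE (negbTE wq) andbF mulr0.
rewrite big1 ?addr0// => w wp; rewrite big1// => x _.
by rewrite mxE (negbTE wp) mulr0.
Qed.

Lemma tensor_applyD T e f :
  tensor_apply T (e + f) = tensor_apply T e + tensor_apply T f.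
Proof.
apply/matrixP => i j; rewrite !mxE -big_split; apply: eq_bigr => k _.
by rewrite -big_split; apply: eq_bigr => l _; rewrite mxE mulrDr.
Qed.

Lemma tensor_applyZ T (a : R) e :
  tensor_apply T (a *: e) = a *: tensor_apply T e.
Proof.
apply/matrixP => i j; rewrite !mxE mulr_sumr; apply: eq_bigr => k _.
by rewrite mulr_sumr; apply: eq_bigr => l _; rewrite mxE; ring.
Qed.

Lemma tensor_apply0 T : tensor_apply T 0 = 0.
Proof. by rewrite -(scale0r 0) tensor_applyZ !scale0r. Qed.

Lemma tensor_applyN T e : tensor_apply T (- e) = - tensor_apply T e.
Proof. by rewrite -scaleN1r tensor_applyZ scaleN1r. Qed.

Lemma tensor_applyB T e f :
  tensor_apply T (e - f) = tensor_apply T e - tensor_apply T f.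
Proof. by rewrite tensor_applyD tensor_applyN. Qed.

Lemma tensor_apply_sym T e : tensor_symmetric T -> sym_mx (tensor_apply T e).
Proof.
move=> sT; apply/matrixP => i j; rewrite !mxE.
by apply: eq_bigr => k _; apply: eq_bigr => l _; have [_ -> _] := sT j i k l.
Qed.

Lemma tensor_apply_self_adjoint T e f : tensor_symmetric T ->
  ddot (tensor_apply T e) f = ddot e (tensor_apply T f).
Proof.
move=> sT; rewrite /ddot.
under eq_bigr do under eq_bigr do rewrite mxE mulr_suml.
under [RHS]eq_bigr do under eq_bigr do rewrite mxE mulr_sumr.
rewrite pair_bigA [RHS]pair_bigA /=.
under eq_bigr do under eq_bigr do rewrite mulr_suml.
under [RHS]eq_bigr do under eq_bigr do rewrite mulr_sumr.
under eq_bigr do rewrite pair_bigA.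
under [RHS]eq_bigr do rewrite pair_bigA.
rewrite exchange_big; apply: eq_bigr => -[i j] _; apply: eq_bigr => -[k l] _ /=.
by have [-> _ _] := sT i j k l; ring.
Qed.

Definition coercive T (m : R) :=
  forall e, sym_mx e -> m * ddot e e <= ddot (tensor_apply T e) e.

Lemma coercive_posdef T m : 0 < m -> coercive T m -> tensor_posdef T.
Proof.
move=> m0 cT e se e0; apply: lt_le_trans (cT e se).
rewrite mulr_gt0// lt_neqAle ddot_ge0 andbT eq_sym.
by apply: contra_neq e0; exact: ddot_eq0.
Qed.

(** On antisymmetric matrices [T] vanishes; adding the antisymmetric part
turns it into an invertible map on all matrices, to which Cramer's rule
applies. *)
Definition extended_apply T e : M := tensor_apply T e + (e - e^T).

Lemma sym_mxD e f : sym_mx e -> sym_mx f -> sym_mx (e + f).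
Proof. by move=> se sf; rewrite /sym_mx linearD /= se sf. Qed.

Lemma sym_mxZ (a : R) e : sym_mx e -> sym_mx (a *: e).
Proof. by move=> se; rewrite /sym_mx linearZ /= se. Qed.

Lemma sym_mxB e f : sym_mx e -> sym_mx f -> sym_mx (e - f).
Proof. by move=> se sf; rewrite -scaleN1r; apply/sym_mxD/sym_mxZ. Qed.

Fact extended_apply_linear T : linear (extended_apply T).
Proof.
move=> a e f; rewrite /extended_apply tensor_applyD tensor_applyZ linearP.
rewrite !scalerDr scalerN opprD; set u := tensor_apply _ _; set v := tensor_apply _ _.
by rewrite !addrA; apply/matrixP => i j; rewrite !mxE; ring.
Qed.
HB.instance Definition _ T := GRing.isLinear.Build R M M *:%R
  (extended_apply T) (extended_apply_linear T).

Definition extended_mx T : 'M[R]_(d * d) := lin_mx (extended_apply T).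

Definition sym_delta (k l : 'I_d) : M := 2^-1 *: (delta_mx k l + delta_mx l k).

Definition extended_inv T s : M := vec_mx (mxvec s *m invmx (extended_mx T)).

Fact extended_inv_linear T : linear (extended_inv T).
Proof.
by move=> a e f; rewrite /extended_inv linearP mulmxDl -scalemxAl linearP.
Qed.
HB.instance Definition _ T := GRing.isLinear.Build R M M *:%R
  (extended_inv T) (extended_inv_linear T).

(** The components of the inverse on symmetric matrices. Symmetrizing the basis
matrices gives this tensor the minor symmetries. *)
Definition inv_tensor T : tensor4 R d :=
  fun i j k l => extended_inv T (sym_delta k l) i j.

Lemma posdef_inj T e : tensor_posdef T -> sym_mx e -> tensor_apply T e = 0 ->
  e = 0.
Proof.
move=> pT se Te0; apply: contrapT => /eqP e0.
have := pT e se e0; rewrite Te0 /ddot.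
under eq_bigr do under eq_bigr do rewrite mxE mul0r.
by rewrite big1 ?ltxx// => i _; rewrite big1.
Qed.

Section inverse.
Variable T : tensor4 R d.
Hypotheses (sT : tensor_symmetric T) (pT : tensor_posdef T).

Lemma extended_apply_sym e s : sym_mx s -> extended_apply T e = s ->
  sym_mx e /\ tensor_apply T e = s.
Proof.
move=> ss es; suff se : sym_mx e.
  by split=> //; rewrite -es /extended_apply se subrr addr0.
have := congr1 trmx es.
rewrite /extended_apply !linearD linearN /= trmxK ss (tensor_apply_sym _ sT) -es.
move/addrI => h; apply/matrixP => i j; have := congr1 (fun X : M => X i j) h.
by rewrite !mxE; lra.
Qed.

Lemma extended_mx_unit : extended_mx T \in unitmx.
Proof.
rewrite -row_free_unit; apply: inj_row_free => v.
rewrite -[v in v *m _](vec_mxK v) /extended_mx mul_vec_lin => /eqP.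
rewrite mxvec_eq0 => /eqP /(extended_apply_sym (trmx0 _ _ _))[se].
by move=> /(posdef_inj pT se) v0; rewrite -(vec_mxK v) v0 linear0.
Qed.

Lemma extended_invP s : sym_mx s ->
  sym_mx (extended_inv T s) /\ tensor_apply T (extended_inv T s) = s.
Proof.
move=> ss; apply: extended_apply_sym => //; apply: (can_inj mxvecK).
by rewrite -mul_vec_lin /extended_inv vec_mxK mulmxKV// extended_mx_unit.
Qed.

Lemma tensor_invP s : sym_mx s ->
  sym_mx (tensor_inv T s) /\ tensor_apply T (tensor_inv T s) = s.
Proof.
move=> ss; rewrite /tensor_inv; case: xgetP => [e -> //|/(_ (extended_inv T s))].
by case; exact: extended_invP.
Qed.

Lemma tensor_inv_unique e s : sym_mx e -> tensor_apply T e = s ->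
  tensor_inv T s = e.
Proof.
move=> se Te; have ss : sym_mx s by rewrite -Te; exact: tensor_apply_sym.
have [ss' Ts] := tensor_invP ss.
apply/eqP; rewrite -subr_eq0; apply/eqP; apply: (posdef_inj pT).
  exact: sym_mxB.
by rewrite tensor_applyB Ts Te subrr.
Qed.

(** Turns the pointwise inverse, defined by choice, into a tensor with explicit
components. *)
Lemma tensor_invE s : sym_mx s -> tensor_inv T s = tensor_apply (inv_tensor T) s.
Proof.
move=> ss; have [se Te] := extended_invP ss.
rewrite (tensor_inv_unique se Te).
have {1}-> : s = \sum_k \sum_l s k l *: sym_delta k l.
  have e1 : s = \sum_k \sum_l s k l *: delta_mx k l := matrix_sum_delta s.
  have e2 : s = \sum_k \sum_l s k l *: delta_mx l k.
    rewrite {1}e1 exchange_big; apply: eq_bigr => k _; apply: eq_bigr => l _.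
    by rewrite -{1}ss mxE.
  transitivity (2^-1 *: (s + s)).
    by apply/matrixP => i j; rewrite !mxE; lra.
  rewrite [X in X + _]e1 [X in _ + X]e2 -big_split scaler_sumr.
  apply: eq_bigr => k _; rewrite -big_split scaler_sumr.
  by apply: eq_bigr => l _; rewrite /= -scalerDr scalerA mulrC -scalerA.
apply/matrixP => i j; rewrite linear_sum summxE mxE; apply: eq_bigr => k _.
rewrite linear_sum summxE; apply: eq_bigr => l _.
by rewrite linearZ mxE mulrC.
Qed.

Lemma inv_tensor_symmetric : tensor_symmetric (inv_tensor T).
Proof.
have sd k l : sym_mx (sym_delta k l).
  by rewrite /sym_mx /sym_delta linearZ linearD /= !trmx_delta addrC.
move=> i j k l; have [s1 T1] := extended_invP (sd k l).
have [s2 T2] := extended_invP (sd i j).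
have dd e (se : sym_mx e) u v : ddot e (sym_delta u v) = e u v.
  rewrite ddotZr ddotDr.
  rewrite !ddot_delta (_ : e v u = e u v); last by rewrite -{1}se mxE.
  lra.
split.
- rewrite /inv_tensor -(dd _ s1) -[RHS](dd _ s2).
  by rewrite -{1}T2 -{2}T1 ddotC tensor_apply_self_adjoint.
- by rewrite /inv_tensor -{1}s1 mxE.
- by rewrite /inv_tensor /sym_delta [in RHS]addrC.
Qed.

(** Coercivity gives [m |e|^2 <= s : e] for [e = T^-1 s]; the rest is the
nonnegativity of [|s - m e|^2]. *)
Lemma coercive_inv_le m s : 0 < m -> coercive T m -> sym_mx s ->
  ddot (extended_inv T s) (extended_inv T s) <= m ^- 2 * ddot s s.
Proof.
move=> m0 cT ss; have [se Te] := extended_invP ss.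
have := cT _ se; rewrite Te; set e := extended_inv T s => h.
have := ddot_ge0 (s + (- m) *: e).
rewrite ddotDl !ddotDr !ddotZl !ddotZr (ddotC e s) => h2.
by rewrite mulrC ler_pdivlMr ?exprn_gt0//; nra.
Qed.

(** A bound on the compliance by the coercivity constant alone, hence uniform
in space. *)
Lemma inv_tensor_le (m : R) i j k l : 0 < m -> coercive T m ->
  `|inv_tensor T i j k l| <= m^-1.
Proof.
move=> m0 cT; have sd : sym_mx (sym_delta k l).
  by rewrite /sym_mx /sym_delta linearZ linearD /= !trmx_delta addrC.
have sd1 : ddot (sym_delta k l) (sym_delta k l) <= 1.
  rewrite {2}/sym_delta ddotZr ddotDr !ddot_delta !mxE !eqxx /=.
  by case: (k == l); case: (l == k) => /=; lra.
have mV0 : 0 <= m^-1 by rewrite invr_ge0 ltW.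
rewrite -(@ler_pXn2r _ 2) ?nnegrE//.
rewrite real_normK ?num_real//.
apply: (le_trans (sqr_le_ddot (extended_inv T (sym_delta k l)) i j)).
apply: (le_trans (coercive_inv_le m0 cT sd)).
by rewrite exprVn -[leRHS]mulr1 ler_wpM2l// invr_ge0 sqr_ge0.
Qed.

End inverse.

Lemma inv_tensor_posdef T : tensor_symmetric T -> tensor_posdef T ->
  tensor_posdef (inv_tensor T).
Proof.
move=> sT pT s ss s0; rewrite -tensor_invE//.
have [se Te] := tensor_invP sT pT ss.
rewrite -[X in ddot _ X]Te ddotC; apply: pT => //.
by apply: contra_neq s0 => e0; rewrite -Te e0 tensor_apply0.
Qed.

End tensor_algebra.

(** * Stiffness and compliance fields *)

Section measurable_matrices.
Context d (T : measurableType d) (R : realType).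

Lemma measurable_inv : measurable_fun [set: R] (@GRing.inv R).
Proof.
rewrite -(setUv [set 0 : R]); apply/measurable_funU => //; first exact: measurableC.
split; first exact: measurable_fun_set1.
apply: open_continuous_measurable_fun; first exact/closed_openC/closed_eq.
by move=> x /[!inE] /= x0; apply: inv_continuous; apply/eqP.
Qed.

Lemma measurable_det m (B : T -> 'M[R]_m) :
  (forall i j, measurable_fun setT (fun x => B x i j)) ->
  measurable_fun setT (fun x => \det (B x)).
Proof.
move=> mB; rewrite /determinant; apply: measurable_sum => s.
apply: measurable_funM; first exact: measurable_cst.
by apply: measurable_prod => i _; exact: mB.
Qed.

Lemma measurable_cofactor m (B : T -> 'M[R]_m) i j :
  (forall i j, measurable_fun setT (fun x => B x i j)) ->
  measurable_fun setT (fun x => cofactor (B x) i j).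
Proof.
move=> mB; apply: measurable_funM; first exact: measurable_cst.
apply: measurable_det => k l; rewrite (_ : (fun _ => _) = fun x => B x (lift i k) (lift j l)).
  exact: mB.
by apply/funext => x; rewrite !mxE.
Qed.

End measurable_matrices.

Section moduli.
Context (R : realType) (n : nat) (A : 'M[R]_n.+1) (V : set 'rV[R]_n.+1).
Hypothesis cellV : unit_cell A V.
Local Notation Rn := 'rV[R]_n.+1.
Local Notation LRn := (lebesgue_space R n).
Local Notation mu := (@lebesgue R n).
Local Notation lmeasurable f := (measurable_fun [set: LRn] (f : LRn -> R)).

(** A class that is stable under pointwise inversion and contains both the
uniform reference stiffness and the stiffness of the composite, so that one
theory of energy forms serves all the quadratic terms. *)
Definition moduli (K : Rn -> tensor4 R n.+1) : Prop :=
  [/\ forall i j k l, lmeasurable (fun x => K x i j k l),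
      periodic A K,
      ae (fun x => tensor_symmetric (K x) /\ tensor_posdef (K x)) &
      forall i j k l, exists C, ae (fun x => `|K x i j k l| <= C)].

Lemma moduli_cst (T : tensor4 R n.+1) : tensor_symmetric T -> tensor_posdef T ->
  moduli (fun=> T).
Proof.
move=> sT pT; split.
- by move=> i j k l; exact: measurable_cst.
- by move=> z; exact: aeW.
- exact: aeW.
- by move=> i j k l; exists `|T i j k l|; exact: aeW.
Qed.

Variable L : Rn -> tensor4 R n.+1.
Hypothesis elL : elasticity_field A V L.

Lemma elasticity_coercive :
  exists2 m, 0 < m & ae (fun x => tensor_symmetric (L x) /\ coercive (L x) m).
Proof.
case: elL => _ _ sL _ [m m0 cL]; exists m => //.
exact: filterS2 sL cL.
Qed.

Lemma moduli_elasticity : moduli L.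
Proof.
have [m m0 cL] := elasticity_coercive.
case: elL => mL pL sL bL _; split => //.
  by apply: filterS cL => x [? c]; split => //; exact: coercive_posdef c.
move=> i j k l; have [C bC] := bL i j k l; exists C.
apply: (ae_unit_cell cellV _ bC).
exact: (periodic_comp (fun T : tensor4 R n.+1 => `|T i j k l| <= C : Prop) pL).
Qed.

Lemma lmeasurable_extended_mx p q : lmeasurable (fun x => extended_mx (L x) p q).
Proof.
case: elL => mL _ _ _ _.
have mTe i j (e : 'M[R]_n.+1) : lmeasurable (fun x => tensor_apply (L x) e i j).
  rewrite (_ : (fun _ => _) = fun x => \sum_k \sum_l L x i j k l * e k l).
    apply: (@measurable_sum _ LRn) => k; apply: (@measurable_sum _ LRn) => l.
    by apply: measurable_funM; [exact: mL|exact: measurable_cst].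
  by apply/funext => x; rewrite mxE.
case/mxvec_indexP: q => i j.
rewrite (_ : (fun _ => _) = fun x => tensor_apply (L x) (vec_mx (delta_mx 0 p)) i j +
  (vec_mx (delta_mx 0 p) - (vec_mx (delta_mx 0 p))^T) i j); last first.
  by apply/funext => x; rewrite mxE /= mxvecE mxE.
by apply: measurable_funD; [exact: mTe|exact: measurable_cst].
Qed.

(** Cramer's rule is a rational formula in the components; it holds where [L]
is definite, that is almost everywhere, and the measure is complete. *)
Lemma lmeasurable_inv_tensor i j k l :
  lmeasurable (fun x => inv_tensor (L x) i j k l).
Proof.
have [_ _ pL _] := moduli_elasticity.
pose B x := extended_mx (L x).
pose s := mxvec (sym_delta R k l).
apply: (@ae_lmeasurable _ _ (fun x => \sum_p s ord0 p *
    ((\det (B x))^-1 * cofactor (B x) (mxvec_index i j) p))).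
  apply: filterS pL => x [sL pL].
  rewrite /inv_tensor /extended_inv -/s mxE /= mxE; apply: eq_bigr => p _.
  by rewrite /invmx extended_mx_unit// !mxE.
apply: (@measurable_sum _ LRn) => p.
apply: measurable_funM; first exact: measurable_cst.
apply: measurable_funM.
  have mdet : lmeasurable (fun x => \det (B x)).
    by apply: (@measurable_det _ LRn) => *; exact: lmeasurable_extended_mx.
  exact: (measurableT_comp (@measurable_inv R) mdet).
by apply: (@measurable_cofactor _ LRn) => *; exact: lmeasurable_extended_mx.
Qed.

Lemma moduli_compliance : moduli (fun x => inv_tensor (L x)).
Proof.
have [_ pL sL _] := moduli_elasticity.
split; first exact: lmeasurable_inv_tensor.
- exact: (periodic_comp (@inv_tensor R n.+1) pL).
- apply: filterS sL => x [sx px]; split; first exact: inv_tensor_symmetric.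
  exact: inv_tensor_posdef.
- have [m m0 cL] := elasticity_coercive; move=> i j k l; exists m^-1.
  apply: filterS cL => x [sx cx]; apply: inv_tensor_le => //.
  exact: coercive_posdef cx.
Qed.

End moduli.

(** * Tensor fields and energetic products *)

Section tensor_fields_theory.
Context (R : realType) (n : nat) (A : 'M[R]_n.+1) (V : set 'rV[R]_n.+1).
Hypothesis cellV : unit_cell A V.
Local Notation Rn := 'rV[R]_n.+1.
Local Notation LRn := (lebesgue_space R n).
Local Notation mu := (@lebesgue R n).
Local Notation lmeasurable f := (measurable_fun [set: LRn] (f : LRn -> R)).
Local Notation field := (Rn -> 'M[R]_n.+1).
Local Notation H := (tensor_fields A).
Implicit Types (f g h : field) (K : Rn -> tensor4 R n.+1).

Let mV : measurable (V : set LRn). Proof. by case: cellV. Qed.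

Lemma tensor_fieldsD f g : H f -> H g -> H (f + g).
Proof.
move=> [sf Lf] [sg Lg]; split.
  by apply: filterS2 sf sg => x sf sg; exact: sym_mxD.
move=> i j; have [pf Lfij] := Lf i j; have [pg Lgij] := Lg i j.
have e : (fun x => (f + g) x i j) = (fun x => f x i j + g x i j).
  by apply/funext => x; rewrite mxE.
by rewrite e; split; [exact: (periodic_comp2 +%R pf pg)|exact: L2locD].
Qed.

Lemma tensor_fieldsZ (a : R) f : H f -> H (a *: f).
Proof.
move=> [sf Lf]; split; first by apply: filterS sf => x sf; exact: sym_mxZ.
move=> i j; have [pf Lfij] := Lf i j.
have e : (fun x => (a *: f) x i j) = (fun x => a * f x i j).
  by apply/funext => x; rewrite mxE.
rewrite e; split; first exact: (periodic_comp ( *%R a) pf).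
apply: (L2locM (C := `|a|)) Lfij; first exact: measurable_cst.
exact: aeW.
Qed.

Lemma tensor_fieldsB f g : H f -> H g -> H (f - g).
Proof.
move=> Hf Hg; rewrite (_ : f - g = f + -1 *: g); last by rewrite scaleN1r.
exact: (tensor_fieldsD Hf (tensor_fieldsZ (-1) Hg)).
Qed.

Lemma tensor_fields_ae f g : field_eq f g -> H f -> H g.
Proof.
move=> fg [sf Lf]; split; first by apply: filterS2 fg sf => x ->.
move=> i j; have [pf Lfij] := Lf i j.
have fgij : ae (fun x => f x i j = g x i j) by apply: filterS fg => x ->.
by split; [exact: periodic_ae fgij pf|exact: L2loc_ae fgij Lfij].
Qed.

Lemma tensor_fields_apply K f : moduli A K -> H f -> H (field_apply K f).
Proof.
move=> [mK pK sK bK] [sf Lf]; split.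
  by apply: filterS sK => x [sKx _]; exact: tensor_apply_sym.
move=> i j.
have e : (fun x => field_apply K f x i j) =
         (fun x => \sum_k \sum_l K x i j k l * f x k l).
  by apply/funext => x; rewrite mxE.
rewrite e; split.
  have pKf := ae_forall_count (fun k => ae_forall_count (fun l => (Lf k l).1 _)).
  move=> z; apply: filterS2 (pK z) (pKf z) => x -> fx.
  by apply: eq_bigr => k _; apply: eq_bigr => l _; rewrite fx.
apply: L2loc_sum => k; apply: L2loc_sum => l.
have [C bC] := bK i j k l.
exact: (L2locM (mK i j k l) bC (Lf k l).2).
Qed.

Lemma field_inv_ae K f : moduli A K -> H f ->
  field_eq (field_apply (fun x => inv_tensor (K x)) f) (field_inv K f).
Proof.
move=> [_ _ sK _] [sf _].
by apply: filterS2 sK sf => x [sKx pKx] sfx; rewrite /field_inv tensor_invE.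
Qed.

Lemma ddot_lmeasurable f g : H f -> H g -> lmeasurable (fun x => ddot (f x) (g x)).
Proof.
move=> [_ Lf] [_ Lg].
apply: (@measurable_sum _ LRn) => i; apply: (@measurable_sum _ LRn) => j.
by apply: measurable_funM; [have [_ []] := Lf i j|have [_ []] := Lg i j].
Qed.

Lemma ddot_integrable f g : H f -> H g ->
  mu.-integrable V (EFin \o (fun x => ddot (f x) (g x))).
Proof.
move=> [_ Lf] [_ Lg].
have e : EFin \o (fun x => ddot (f x) (g x)) = fun x : LRn =>
    (\sum_i \sum_j (f x i j * g x i j)%:E)%E.
  apply/funext => x; rewrite /= -sumEFin; apply: eq_bigr => i _.
  by rewrite sumEFin.
rewrite e; apply: (@integrable_sum _ LRn) => // i _.
apply: (@integrable_sum _ LRn) => // j _.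
exact: (L2per_mul_integrable cellV (Lf i j) (Lg i j)).
Qed.

Lemma average_ae (u v : Rn -> R) : lmeasurable u -> lmeasurable v ->
  ae (fun x => u x = v x) -> average V u = average V v.
Proof.
move=> mu_ mv uv; congr (_ * fine _); apply: ae_eq_integral.
- exact: mV.
- by apply: measurable_funTS; exact/measurable_EFinP.
- by apply: measurable_funTS; exact/measurable_EFinP.
- by apply: filterS uv => x ->.
Qed.

Definition pairing f g : R := average V (fun x => ddot (f x) (g x)).

Lemma pairingC f g : pairing f g = pairing g f.
Proof.
by rewrite /pairing; congr average; apply/funext => x; exact: ddotC.
Qed.

Lemma pairingDl f g h : H f -> H g -> H h ->
  pairing (f + g) h = pairing f h + pairing g h.
Proof.
move=> Hf Hg Hh; rewrite /pairing /average -mulrDr; congr (_ * _).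
rewrite -(RintegralD mV (ddot_integrable Hf Hh) (ddot_integrable Hg Hh)).
by apply: eq_Rintegral => x _; rewrite /= ddotDl.
Qed.

Lemma pairingZl (a : R) f g : H f -> H g -> pairing (a *: f) g = a * pairing f g.
Proof.
move=> Hf Hg; rewrite /pairing /average mulrCA; congr (_ * _).
rewrite -(RintegralZl a mV (ddot_integrable Hf Hg)).
by apply: eq_Rintegral => x _; rewrite /= ddotZl.
Qed.

Lemma pairingBl f g h : H f -> H g -> H h ->
  pairing (f - g) h = pairing f h - pairing g h.
Proof.
move=> Hf Hg Hh; rewrite (_ : f - g = f + -1 *: g); last by rewrite scaleN1r.
by rewrite (pairingDl Hf (tensor_fieldsZ _ Hg) Hh) (pairingZl _ Hg Hh) mulN1r.
Qed.

Lemma pairing_ael f f' g : H f -> H g -> field_eq f f' ->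
  pairing f g = pairing f' g.
Proof.
move=> Hf Hg ff'; apply: average_ae.
- exact: ddot_lmeasurable Hf Hg.
- exact: ddot_lmeasurable (tensor_fields_ae ff' Hf) Hg.
- by apply: filterS ff' => x ->.
Qed.

Lemma lebesgue_unit_cell : (mu V < +oo)%E.
Proof.
have uA : A \in unitmx by case: cellV.
have [M QM] := parallelepiped_sub_cube uA.
have := ge0_integral_unit_cell cellV (f := cst 1%E).
rewrite !integral_cst ?mul1e//; last exact: measurable_parallelepiped.
move=> -> //; last by move=> z; exact: aeW.
exact: le_lt_trans (le_outer_measure _ _ _ QM) (lebesgue_cube _ _).
Qed.

(** With [K = L0] this is the energetic product of strains, and with
[K = L0^-1] that of stresses. *)
Definition energy K f g : R := pairing (field_apply K f) g.

Section energy_form.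
Variable K : Rn -> tensor4 R n.+1.
Hypothesis modK : moduli A K.
Local Notation form := (energy K).
Let HK f : H f -> H (field_apply K f). Proof. exact: tensor_fields_apply. Qed.

Lemma energyE f g : H f -> H g -> form f g = pairing f (field_apply K g).
Proof.
move=> Hf Hg; have [_ _ sK _] := modK; apply: average_ae.
- exact: ddot_lmeasurable (HK Hf) Hg.
- exact: ddot_lmeasurable Hf (HK Hg).
- by apply: filterS sK => x [sKx _]; exact: tensor_apply_self_adjoint.
Qed.

Lemma energyC f g : H f -> H g -> form f g = form g f.
Proof. by move=> Hf Hg; rewrite (energyE Hf Hg) pairingC. Qed.

Lemma energyDl f g h : H f -> H g -> H h -> form (f + g) h = form f h + form g h.
Proof.
move=> Hf Hg Hh; rewrite /energy -(pairingDl (HK Hf) (HK Hg) Hh).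
by congr pairing; apply/funext => x; exact: tensor_applyD.
Qed.

Lemma energyZl (a : R) f g : H f -> H g -> form (a *: f) g = a * form f g.
Proof.
move=> Hf Hg; rewrite /energy -(pairingZl _ (HK Hf) Hg).
by congr pairing; apply/funext => x; exact: tensor_applyZ.
Qed.

Lemma energyBl f g h : H f -> H g -> H h -> form (f - g) h = form f h - form g h.
Proof.
move=> Hf Hg Hh; rewrite (_ : f - g = f + -1 *: g); last by rewrite scaleN1r.
by rewrite (energyDl Hf (tensor_fieldsZ _ Hg) Hh) (energyZl _ Hg Hh) mulN1r.
Qed.

Lemma energyDr f g h : H f -> H g -> H h -> form h (f + g) = form h f + form h g.
Proof.
move=> Hf Hg Hh; rewrite (energyC Hh (tensor_fieldsD Hf Hg)).
by rewrite (energyDl Hf Hg Hh) (energyC Hf Hh) (energyC Hg Hh).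
Qed.

Lemma energyZr (a : R) f g : H f -> H g -> form g (a *: f) = a * form g f.
Proof.
move=> Hf Hg; rewrite (energyC Hg (tensor_fieldsZ a Hf)).
by rewrite (energyZl _ Hf Hg) (energyC Hf Hg).
Qed.

Lemma energyBr f g h : H f -> H g -> H h -> form h (f - g) = form h f - form h g.
Proof.
move=> Hf Hg Hh; rewrite (energyC Hh (tensor_fieldsB Hf Hg)).
by rewrite (energyBl Hf Hg Hh) (energyC Hf Hh) (energyC Hg Hh).
Qed.

Lemma energy_ael f f' g : H f -> H g -> field_eq f f' -> form f g = form f' g.
Proof.
move=> Hf Hg ff'; apply: (pairing_ael (HK Hf) Hg).
by apply: filterS ff' => x; rewrite /field_apply => ->.
Qed.

Lemma energy_inv f g : H f -> H g ->
  form (field_inv K f) g = pairing f g.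
Proof.
move=> Hf Hg; apply/esym; apply: (pairing_ael Hf Hg).
have [_ _ sK _] := modK; have [sf _] := Hf.
apply: filterS2 sK sf => x [sKx pKx] sfx.
by rewrite /field_apply /field_inv (tensor_invP sKx pKx sfx).2.
Qed.

Let form_dens f x := ddot (field_apply K f x) (f x).

Let form_dens_ge0 f : H f -> ae (fun x => form_dens f x = `|form_dens f x|).
Proof.
move=> [sf _]; have [_ _ sK _] := modK.
apply: filterS2 sf sK => x sfx [_ pKx]; apply/esym/ger0_norm.
have [f0|f0] := eqVneq (f x) 0; last exact/ltW/pKx.
by rewrite /form_dens f0 ddot0r.
Qed.

Let measurable_form_dens f : H f -> lmeasurable (form_dens f).
Proof. by move=> Hf; exact: ddot_lmeasurable (HK Hf) Hf. Qed.

(** The density of the energy is nonnegative almost everywhere only, so it is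
first replaced by its absolute value. *)
Lemma energy_ge0 f : H f -> 0 <= form f f.
Proof.
move=> Hf; rewrite /energy /pairing -/(form_dens f).
rewrite (average_ae _ _ (form_dens_ge0 Hf)).
- by apply: mulr_ge0; [rewrite invr_ge0 fine_ge0|exact: Rintegral_ge0].
- exact: measurable_form_dens.
- exact/measurableT_comp/measurable_form_dens.
Qed.

(** A null energy makes the density vanish almost everywhere in the cell, hence
so does the field there by definiteness of [K], and then everywhere by
periodicity. When the cell is a null set the first step holds vacuously and the
others are the same. *)
Lemma energy_eq0 f : H f -> form f f = 0 -> field_eq f (cst 0).
Proof.
move=> Hf /eqP f0.
have dens0 : ae (fun x => V x -> form_dens f x = 0).
  move: f0; rewrite /energy /pairing /average mulf_eq0 invr_eq0 => /orP[|].
    rewrite fine_eq0; last by rewrite ge0_fin_numE//; exact: lebesgue_unit_cell.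
    by move=> /eqP V0; exists V; split => // x /= /not_implyP[].
  move=> /eqP int0; have iK := ddot_integrable (HK Hf) Hf.
  have mD : measurable_fun (V : set LRn) (EFin \o form_dens f : LRn -> \bar R).
    by case/integrableP : iK.
  have : ae (fun x => V x -> (form_dens f x)%:E = 0%E); last first.
    by apply: filterS => x Dx /Dx[].
  apply/(ae_eq_integral_abs mu mV mD).
  transitivity (\int[mu]_(x in V) (form_dens f x)%:E)%E.
    apply: ae_eq_integral; [exact: mV|exact: measurableT_comp mD|exact: mD|].
    by apply: filterS (form_dens_ge0 Hf) => x e _; rewrite /= -e.
  rewrite -[LHS]fineK; first by congr EFin; exact: int0.
  exact: (integrable_fin_num mV iK).
have [_ _ sK _] := modK; have [sf Lf] := Hf.
have pf : periodic A f.
  move=> z; have := ae_forall_count (fun i => ae_forall_count (fun j => (Lf i j).1 z)).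
  by apply: filterS => x e; apply/matrixP => i j; exact: e.
apply: (ae_unit_cell cellV); first exact: (periodic_comp (fun e => e = 0 : Prop) pf).
apply: filterS3 dens0 sf sK => x d0 sfx [_ pKx] /d0.
apply: contraPeq => f0x; apply/eqP; rewrite gt_eqF//; exact: pKx.
Qed.

End energy_form.
End tensor_fields_theory.

(** * Flat functions on the line *)

Section flat_functions.
Context (R : realType).
Implicit Types (p : {poly R}) (t : R).

(** The generality in [p] makes the class stable under differentiation
([is_derive_flat]), which yields derivatives of all orders at once. *)
Definition flat p t : R := if 0 < t then p.[t^-1] * expR (- t^-1) else 0.

Definition flat_deriv p : {poly R} := 'X^2 * (p - p^`()).

(** For [u = 1 / t >= 1], [p.[u]] is at most a constant times [u ^ m] while
[expR u] exceeds [u ^ m.+1 / m.+1`!], so the product is of order [1 / u = t]. *)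
Lemma flat_le p : exists C, forall t, `|t| <= 1 -> `|flat p t| <= C * `|t|.
Proof.
pose m := size p.
exists ((\sum_(i < m) `|p`_i|) * m.+1`!%:R) => t t1.
have S0 : 0 <= \sum_(i < m) `|p`_i| by exact: sumr_ge0.
rewrite /flat; case: ifPn => [t0|_]; last first.
  by rewrite normr0 !mulr_ge0.
rewrite gtr0_norm // in t1 *.
pose u := t^-1; have u1 : 1 <= u by rewrite -[1]invr1 lef_pV2 ?posrE.
have u0 : 0 < u by rewrite invr_gt0.
rewrite -[t^-1]/u normrM (ger0_norm (expR_ge0 _)) -[t]invrK -[t^-1]/u.
have pu : `|p.[u]| <= (\sum_(i < m) `|p`_i|) * u ^+ m.
  rewrite horner_coef mulr_suml; apply: le_trans (ler_norm_sum _ _ _) _.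
  apply: ler_sum => i _; rewrite normrM ler_wpM2l// normrX gtr0_norm//.
  by rewrite ler_weXn2l// ltnW.
have eu : expR (- u) <= m.+1`!%:R / u ^+ m.+1.
  rewrite expRN -[leRHS]invrK lef_pV2 ?posrE ?expR_gt0 ?invr_gt0 ?divr_gt0 ?exprn_gt0 ?ltr0n ?fact_gt0//.
  rewrite invf_div; have := expR_ge1Dxn m (ltW u0); lra.
apply: (le_trans (ler_pM (normr_ge0 _) (expR_ge0 _) pu eu)).
rewrite exprS invfM.
have um : u ^+ m != 0 by rewrite expf_neq0// gt_eqF.
by rewrite le_eqVlt; apply/orP; left; apply/eqP; field; rewrite um gt_eqF.
Qed.

Lemma flat_cvg0 p : flat p t @[t --> 0] --> (0 : R).
Proof.
have [C pC] := flat_le p.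
apply/cvgr0Pnorm_lt => e e0; near=> t.
have C1 : 0 < `|C| + 1 by rewrite ltr_wpDl.
have t1 : `|t| <= 1 by near: t; apply: cvgr0_norm_le; [exact: cvg_id|].
apply: le_lt_trans (pC _ t1) _.
apply: (@le_lt_trans _ _ ((`|C| + 1) * `|t|)).
  by rewrite ler_wpM2r// (le_trans (ler_norm C))// lerDl.
rewrite mulrC -ltr_pdivlMr//.
by near: t; apply: cvgr0_norm_lt; [exact: cvg_id|exact: divr_gt0].
Unshelve. all: by end_near. Qed.

Lemma is_derive_flat p t : is_derive t 1 (flat p) (flat (flat_deriv p) t).
Proof.
have [t0|t0|->] := ltgtP t 0.
- rewrite {2}/flat ltNge (ltW t0) /=.
  apply: (near_eq_is_derive _ (is_derive_cst (0 : R) t 1)).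
  near=> s; rewrite /flat ltNge ifF//; apply/negbTE; rewrite negbK ltW//.
  by near: s; exact: lt_nbhsl.
- rewrite {2}/flat t0.
  have tn0 : t != 0 by rewrite gt_eqF.
  have dV : is_derive t 1 (fun s : R => s^-1) (- t ^- 2).
    by have := is_deriveV tn0 (is_derive_id t 1); rewrite /GRing.scale /= mulr1.
  have d1 := is_derive1_comp (is_derive_poly p t^-1) dV.
  have d2 := @is_derive1_comp _ expR (fun s => - s^-1) _ _ _ (is_derive_expR (- t^-1)) (is_deriveN dV).
  have d3 : is_derive t 1 (fun s => p.[s^-1] * expR (- s^-1))
      ((flat_deriv p).[t^-1] * expR (- t^-1)).
    apply: (is_derive_eq (is_deriveM d1 d2)).
    rewrite /flat_deriv !hornerE /GRing.scale /=.
    by rewrite exprVn; ring.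
  apply: (near_eq_is_derive _ d3).
  by near=> s; rewrite /flat ifT//; near: s; exact: lt_nbhsr.
- rewrite {2}/flat ltxx.
  have q0 : (fun h => h^-1 *: ((flat p \o shift 0) (h *: 1) - flat p 0)) @ 0^' --> (0 : R).
    have k : flat ('X * p) t @[t --> 0^'] --> (0 : R).
      by apply: cvg_within_filter; exact: flat_cvg0.
    apply: cvg_trans k.
    apply: near_eq_cvg; near=> h.
    have h0 : h != 0 by near: h; exact: nbhs_dnbhs_neq.
    rewrite /= /flat ltxx subr0 addr0 /GRing.scale /= mulr1.
    case: ifPn => hp; last by rewrite mulr0.
    by rewrite hornerM hornerX mulrA.
  by split; [apply/cvg_ex; exists 0|exact: cvg_lim q0].
Unshelve. all: by end_near. Qed.
End flat_functions.

(** * Smooth steps and tame functions *)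

Section smooth_step.
Context (R : realType).
Implicit Types t : R.

Lemma continuous_flat p : continuous (@flat R p).
Proof.
move=> t; apply/differentiable_continuous/derivable1_diffP.
by have [] := is_derive_flat p t.
Qed.

Definition step_den t : R := flat 1 t + flat 1 (1 - t).

Lemma flat1_ge0 t : 0 <= flat 1 t.
Proof. by rewrite /flat hornerC mul1r; case: ifP => // _; exact: expR_ge0. Qed.

Lemma flat1_gt0 t : 0 < t -> 0 < flat 1 t.
Proof. by move=> t0; rewrite /flat t0 hornerC mul1r expR_gt0. Qed.

Lemma flat_le0 (p : {poly R}) t : t <= 0 -> flat p t = 0.
Proof. by rewrite /flat ltNge => ->. Qed.

Lemma step_den_gt0 t : 0 < step_den t.
Proof.
rewrite /step_den; have [t0|t0] := lerP t 0.
  by rewrite ltr_wpDl ?flat1_ge0// flat1_gt0// subr_gt0 (le_lt_trans t0).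
by rewrite ltr_pwDl ?flat1_ge0// flat1_gt0.
Qed.

(** A smooth step, equal to 0 before 0 and to 1 after 1. *)
Definition step t : R := flat 1 t * (step_den t)^-1.

Definition step_deriv t : R :=
  (flat (flat_deriv 1) t * flat 1 (1 - t) + flat 1 t * flat (flat_deriv 1) (1 - t))
  / step_den t ^+ 2.

Lemma is_derive_step t : is_derive t 1 step (step_deriv t).
Proof.
have d1 := is_derive_flat 1 t.
have dr : is_derive t 1 (fun s : R => 1 - s) (- 1).
  have := is_deriveB (is_derive_cst (1 : R) t 1) (is_derive_id t 1).
  by rewrite sub0r.
have d2 := @is_derive1_comp _ (flat 1) (fun s => 1 - s) _ _ _ (is_derive_flat 1 (1 - t)) dr.
have D0 : step_den t != 0 by rewrite gt_eqF// step_den_gt0.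
have dD : is_derive t 1 step_den _ := is_deriveD d1 d2.
apply: (is_derive_eq (is_deriveM d1 (is_deriveV D0 dD))).
rewrite /step_deriv /GRing.scale /=; have : step_den t != 0 by [].
by rewrite /step_den => D; field.
Qed.

Lemma step0 t : t <= 0 -> step t = 0.
Proof. by move=> t0; rewrite /step flat_le0 ?mul0r. Qed.

Lemma step1 t : 1 <= t -> step t = 1.
Proof.
move=> t1; have := step_den_gt0 t; rewrite /step /step_den.
by rewrite (@flat_le0 _ (1 - t)) ?subr_le0// addr0 => /gt_eqF/negbT/mulfV.
Qed.

Lemma step_deriv_out t : ~~ (0 <= t <= 1) -> step_deriv t = 0.
Proof.
rewrite negb_and -!ltNge => t01; rewrite /step_deriv.
have [t0|t1] := orP t01.
  by rewrite (flat_le0 _ (ltW t0)) (flat_le0 1 (ltW t0)) !mul0r addr0 mul0r.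
have t1' : 1 - t <= 0 by rewrite subr_le0 ltW.
by rewrite (flat_le0 _ t1') (flat_le0 _ t1') !mulr0 addr0 mul0r.
Qed.

Lemma continuous_step : continuous step.
Proof.
move=> t; apply/differentiable_continuous/derivable1_diffP.
by have [] := is_derive_step t.
Qed.

Lemma continuous_step_deriv : continuous step_deriv.
Proof.
have cr : continuous (fun t : R => 1 - t).
  by move=> t; apply: cvgB; [exact: cvg_cst|exact: cvg_id].
have cf p : continuous (fun t : R => flat p (1 - t)).
  move=> t; apply: (@continuous_comp _ _ _ (fun t : R => 1 - t) (flat p)).
    exact: cr.
  exact: continuous_flat.
move=> t; apply: cvgM.
  by apply: cvgD; apply: cvgM; (exact: continuous_flat || exact: cf).
apply: cvgV; first by rewrite expf_neq0// gt_eqF// step_den_gt0.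
by apply: cvgM; apply: cvgD; (exact: continuous_flat || exact: cf).
Qed.

Lemma step_itv t : 0 <= step t <= 1.
Proof.
rewrite /step mulr_ge0 ?invr_ge0 ?(ltW (step_den_gt0 t)) ?flat1_ge0//=.
by rewrite ler_pdivrMr ?step_den_gt0// mul1r lerDl flat1_ge0.
Qed.

Lemma step_deriv_bounded : exists C, forall t, `|step_deriv t| <= C.
Proof.
have cn : {within `[0, 1], continuous (fun t => `|step_deriv t|)}.
  apply: continuous_subspaceT => t; apply: cvg_norm; exact: continuous_step_deriv.
have [c _ Hc] := EVT_max ler01 cn.
exists `|step_deriv c| => t; have [t01|t01] := boolP (0 <= t <= 1).
  by apply: Hc; rewrite in_itv.
by rewrite step_deriv_out// normr0.
Qed.

(** By telescoping, the integer translates of [hump] add up to 1. *)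
Definition hump t : R := step t - step (t - 1).

Definition hump_deriv t : R := step_deriv t - step_deriv (t - 1).

Lemma is_derive_hump t : is_derive t 1 hump (hump_deriv t).
Proof.
have dr : is_derive t 1 (fun s : R => s - 1) 1.
  have := is_deriveB (is_derive_id t 1) (is_derive_cst (1 : R) t 1).
  by rewrite subr0.
have d2 := @is_derive1_comp _ step (fun s => s - 1) _ _ _ (is_derive_step (t - 1)) dr.
by apply: (is_derive_eq (is_deriveB (is_derive_step t) d2)); rewrite mulr1.
Qed.

End smooth_step.

Section tame_functions.
Context (R : realType) (n : nat).
Local Notation Rn := 'rV[R]_n.+1.

(** A class closed under partial derivatives by construction: all iterated
partial derivatives of its members exist and are continuous because each of
them is again a member. *)
Inductive tame : (Rn -> R) -> Prop :=
| tame_cst c : tame (fun=> c)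
| tame_add f g : tame f -> tame g -> tame (fun x => f x + g x)
| tame_mul f g : tame f -> tame g -> tame (fun x => f x * g x)
| tame_inv f : (forall x, f x != 0) -> tame f -> tame (fun x => (f x)^-1)
| tame_flat p (a c : R) (B : 'M[R]_n.+1) k :
    tame (fun x => flat p (a + c * (x *m B) ord0 k)).

(** Along a line an affine function is affine in the parameter, so the claim is
the chain rule in one variable. *)
Lemma is_derive_comp_affine (g : R -> R) dg (a c : R) (B : 'M[R]_n.+1) k (x v : Rn) :
  is_derive (a + c * (x *m B) ord0 k) 1 g dg ->
  is_derive x v (fun y => g (a + c * (y *m B) ord0 k)) (dg * (c * (v *m B) ord0 k)).
Proof.
move=> dgx; set b := c * (v *m B) ord0 k; set l := a + _ in dgx.
have dl : is_derive (0 : R) 1 (fun h : R => l + h * b) b.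
  have := is_deriveD (is_derive_cst l (0 : R) 1) (is_deriveM (is_derive_id (0 : R) 1) (is_derive_cst b (0 : R) 1)).
  by rewrite /GRing.scale /= mulr1 mul0r !add0r.
have dgx' : is_derive (l + 0 * b) 1 g dg by rewrite mul0r addr0.
have [] := @is_derive1_comp _ g (fun h => l + h * b) _ _ _ dgx' dl.
set G := g \o _; rewrite /derivable /derive.
set q := fun h : R => _.
have -> : q = fun h => h^-1 *: (((fun y => g (a + c * (y *m B) ord0 k)) \o shift x) (h *: v) - g (a + c * (x *m B) ord0 k)).
  apply/funext => h; rewrite /q /G /=; congr (_ *: (g _ - g _)).
    by rewrite /l /b mulmxDl -scalemxAl !mxE /GRing.scale /=; ring.
  by rewrite /l mul0r addr0.
by move=> ? ?; split.
Qed.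

Lemma tame_derive f v : tame f ->
  exists2 g, tame g & forall x, is_derive x v f (g x).
Proof.
elim=> {f} [c|f1 f2 _ [g1 t1 d1] _ [g2 t2 d2]|f1 f2 tf1 [g1 t1 d1] tf2 [g2 t2 d2]|f f0 tf [g tg dg]|p a c B k].
- by exists (fun=> 0) => [|x]; [exact: tame_cst|exact: is_derive_cst].
- exists (fun x => g1 x + g2 x) => [|x]; first exact: tame_add.
  exact: is_deriveD.
- exists (fun x => f1 x * g2 x + f2 x * g1 x) => [|x].
    by apply: tame_add; exact: tame_mul.
  exact: is_deriveM.
- exists (fun x => -1 * ((f x)^-1 * (f x)^-1) * g x) => [|x].
    by do 2 (apply: tame_mul => //); [exact: tame_cst|apply: tame_mul; exact: tame_inv].
  have [df df'] := dg x; apply: DeriveDef; first exact: derivableV.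
  by rewrite (deriveV (f0 x) df) df' mulN1r -invfM -expr2.
- exists (fun x => flat (flat_deriv p) (a + c * (x *m B) ord0 k) * (c * (v *m B) ord0 k)) => [|x].
    by apply: tame_mul; [exact: tame_flat|exact: tame_cst].
  exact/is_derive_comp_affine/is_derive_flat.
Qed.

Lemma continuous_linear_coord (B : 'M[R]_n.+1) k :
  continuous (fun x : Rn => (x *m B) ord0 k).
Proof.
have -> : (fun x : Rn => (x *m B) ord0 k) = fun x : Rn => \sum_j x ord0 j * B j k.
  by apply/funext => y; rewrite mxE.
elim: (index_enum _) => [|j s IH] x.
  by under eq_fun do rewrite big_nil; exact: cst_continuous.
under eq_fun do rewrite big_cons.
apply: continuousD (IH x).
exact: (continuousM (@coord_continuous _ _ _ ord0 j x) (@cst_continuous _ _ _ x)).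
Qed.

Lemma tame_continuous f : tame f -> continuous f.
Proof.
elim=> {f} [c|f1 f2 _ c1 _ c2|f1 f2 _ c1 _ c2|f f0 _ cf|p a c B k] x.
- exact: cst_continuous.
- exact: (continuousD (c1 x) (c2 x)).
- exact: (continuousM (c1 x) (c2 x)).
- exact: (continuousV (f0 x) (cf x)).
- apply: (@continuous_comp _ _ _ (fun x : Rn => a + c * (x *m B) ord0 k) (flat p)).
    apply: (continuousD (@cst_continuous _ _ a x)).
    exact: (continuousM (@cst_continuous _ _ c x) (@continuous_linear_coord B k x)).
  exact: continuous_flat.
Qed.

Lemma tame_iter_partial f s : tame f -> tame (iter_partial s f).
Proof.
move=> tf; elim: s => //= i s IH; have [g tg dg] := tame_derive (delta_mx ord0 i) IH.
rewrite (_ : partial i _ = g)//; apply/funext => x.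
exact: (@derive_val _ _ _ _ _ _ _ (dg x)).
Qed.

Lemma tame_smooth f : tame f -> smooth f.
Proof.
move=> tf s; have ts := tame_iter_partial s tf; split.
  exact: tame_continuous.
move=> x i; have [g _ dg] := tame_derive (delta_mx ord0 i) ts.
by have [] := dg x.
Qed.

Lemma tame_step (a c : R) (B : 'M[R]_n.+1) k :
  tame (fun x => step (a + c * (x *m B) ord0 k)).
Proof.
apply: tame_mul; first exact: tame_flat.
apply: tame_inv => [x|]; first by rewrite gt_eqF// step_den_gt0.
apply: tame_add; first exact: tame_flat.
rewrite (_ : (fun _ => _) = fun x => flat 1 ((1 - a) + (- c) * (x *m B) ord0 k)).
  exact: tame_flat.
by apply/funext => x; congr flat; ring.
Qed.

Lemma tame_hump (B : 'M[R]_n.+1) k : tame (fun x => hump ((x *m B) ord0 k)).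
Proof.
rewrite (_ : (fun _ => _) = fun x => step (0 + 1 * (x *m B) ord0 k) +
    (-1) * step (- 1 + 1 * (x *m B) ord0 k)).
  apply: tame_add; first exact: tame_step.
  by apply: tame_mul; [exact: tame_cst|exact: tame_step].
by apply/funext => x; rewrite /hump mulN1r add0r !mul1r (addrC (-1)).
Qed.

Lemma tame_prod (I : Type) (s : seq I) (F : I -> Rn -> R) :
  (forall i, tame (F i)) -> tame (fun x => \prod_(i <- s) F i x).
Proof.
move=> tF; elim: s => [|i s IH].
  by under eq_fun do rewrite big_nil; exact: tame_cst.
by under eq_fun do rewrite big_cons; exact: tame_mul.
Qed.

Lemma is_derive_prod_ord m (F : 'I_m -> Rn -> R) (dF : 'I_m -> R) (x v : Rn) :
  (forall i, is_derive x v (F i) (dF i)) ->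
  is_derive x v (fun y => \prod_i F i y)
    (\sum_i \prod_j (if j == i then dF i else F j x)).
Proof.
elim: m F dF => [F dF _|m IH F dF dFx].
  rewrite big_ord0; under eq_fun do rewrite big_ord0; exact: is_derive_cst.
under eq_fun do rewrite big_ord_recl.
apply: (is_derive_eq (is_deriveM (dFx ord0) (IH _ _ (fun i => dFx (lift ord0 i))))).
rewrite [RHS]big_ord_recl addrC; congr (_ + _).
  by rewrite [RHS]big_ord_recl eqxx /GRing.scale /= mulrC.
rewrite /GRing.scale /= mulr_sumr; apply: eq_bigr => i _.
by rewrite [RHS]big_ord_recl.
Qed.

End tame_functions.

(** * Periodic functions tested against a partition of unity *)

Section periodic_cancellation.
Context (R : realType) (n : nat) (A : 'M[R]_n.+1) (V : set 'rV[R]_n.+1).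
Hypothesis cellV : unit_cell A V.
Local Notation Rn := 'rV[R]_n.+1.
Local Notation LRn := (lebesgue_space R n).
Local Notation mu := (@lebesgue R n).
Local Notation lmeasurable f := (measurable_fun [set: LRn] (f : LRn -> R)).
Local Notation coord k x := ((x *m invmx A) ord0 k).
Implicit Types (p : Rn -> R) (u : R -> R) (h : 'I_n.+1 -> R -> R).

Let uA : A \in unitmx. Proof. by case: cellV. Qed.

(** The one-dimensional factors: humps and their derivatives, indicators, and
the differences between them. Their common support [0, 2] bounds the support of
their products. *)
Definition profile u : Prop :=
  [/\ measurable_fun [set: R] u, exists C : R, forall t : R, `|u t| <= C &
      forall t : R, ~~ (0 <= t <= 2) -> u t = 0].

Definition coord_prod h (x : Rn) : R := \prod_k h k (coord k x).

Lemma lmeasurable_coord_prod h : (forall k, profile (h k)) ->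
  lmeasurable (coord_prod h).
Proof.
move=> ph; apply: (@measurable_prod _ LRn) => k _; have [mh _ _] := ph k.
exact: (measurableT_comp mh (measurable_linear (invmx A) k)).
Qed.

Lemma coord_prod_bounded h : (forall k, profile (h k)) ->
  exists C, forall x, `|coord_prod h x| <= C.
Proof.
move=> ph; have Ch k : exists C, forall t, `|h k t| <= C by have [] := ph k.
have [C hC] := choice Ch; exists (\prod_k C k) => x.
by rewrite normr_prod; apply: ler_prod => k _; rewrite normr_ge0 hC.
Qed.

Lemma coord_prod_support h : (forall k, profile (h k)) ->
  exists M, forall x, coord_prod h x != 0 -> cube M x.
Proof.
move=> ph.
(* The lattice coordinates range in [0, 2]; [A] maps them back. *)
exists (\sum_j \sum_k 2 * `|A k j|) => x hx i.
have hk k : 0 <= coord k x <= 2.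
  apply: contraNT hx => kx; rewrite /coord_prod (bigD1 k)//=.
  by have [_ _ ->] := ph k; rewrite ?mul0r.
have -> : x ord0 i = (x *m invmx A *m A) ord0 i by rewrite mulmxKV.
rewrite mxE; apply: le_trans (ler_norm_sum _ _ _) _.
apply: (@le_trans _ _ (\sum_k 2 * `|A k i|)).
  apply: ler_sum => k _; rewrite normrM ler_wpM2r//.
  by have := hk k; rewrite ler_norml; lra.
rewrite [leRHS](bigD1 i)//= lerDl.
by apply: sumr_ge0 => j _; apply: sumr_ge0 => k _; rewrite mulr_ge0.
Qed.

Lemma L2loc_mul_integrable p v : L2loc p -> lmeasurable v ->
  (exists C, forall x, `|v x| <= C) -> (exists M, forall x, v x != 0 -> cube M x) ->
  mu.-integrable setT (EFin \o (fun x => p x * v x)).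
Proof.
move=> [mp ip] mv [C vC] [M vM].
have mM := measurable_compact (@compact_cube R n M).
have mpv : measurable_fun [set: LRn] (EFin \o (fun x : Rn => p x * v x) : LRn -> \bar R).
  by apply/measurable_EFinP; exact: measurable_funM.
have -> : EFin \o (fun x : Rn => p x * v x) = (EFin \o (fun x : Rn => p x * v x)) \_ (cube M).
  apply/funext => x; rewrite patchE; case: ifPn => //= /negP xM.
  have [->|v0] := eqVneq (v x) 0; first by rewrite mulr0.
  by exfalso; apply: xM; rewrite inE; exact: vM.
apply/(integrable_mkcond _ mM).
have i1 : mu.-integrable (cube M) (EFin \o (cst (1 : R) : LRn -> R)).
  apply/integrableP; split; first by apply/measurable_EFinP; exact: measurable_cst.
  rewrite (eq_integral (cst 1%E)); last by move=> x _; rewrite /= normr1.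
  by rewrite (integral_cst mu mM) mul1e; exact: lebesgue_cube.
have := @integrableZl _ LRn R mu _ mM C _ (integrableD mM (ip _ (compact_cube M)) i1).
apply: (le_integrable mM); first exact: measurable_funTS.
move=> x _; rewrite /= lee_fin !normrM.
have C0 : 0 <= C := le_trans (normr_ge0 _) (vC x).
rewrite mulrC; apply: ler_pM => //; first by rewrite (ger0_norm C0).
rewrite [leRHS]ger0_norm ?addr_ge0 ?sqr_ge0//.
by rewrite ler_norml; have := sqr_ge0 (p x - 1); have := sqr_ge0 (p x + 1); nra.
Qed.

Lemma coord_prod_integrable p h : L2loc p -> (forall k, profile (h k)) ->
  mu.-integrable setT (EFin \o (fun x => p x * coord_prod h x)).
Proof.
move=> Lp ph; apply: L2loc_mul_integrable => //.
- exact: lmeasurable_coord_prod.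
- exact: coord_prod_bounded.
- exact: coord_prod_support.
Qed.

Definition upd h i u : 'I_n.+1 -> R -> R := fun k => if k == i then u else h k.

Lemma profile_upd h i u : (forall k, profile (h k)) -> profile u ->
  forall k, profile (upd h i u k).
Proof. by move=> ph pu k; rewrite /upd; case: ifP. Qed.

(** A factor that is a difference [u t - u (t - 1)] makes the product the
difference between a function and its translate by a vector of the lattice;
periodic functions have the same integral against both. *)
Lemma integral_periodic_telescope p h i u : L2loc p -> periodic A p ->
  (forall k, profile (h k)) -> profile u -> (forall t : R, h i t = u t - u (t - 1)) ->
  integral_on setT (fun x => p x * coord_prod h x) = 0.
Proof.
move=> Lp pp ph pu hi; set b := lattice_point A (delta_mx ord0 i).
set h' := upd h i u; have ph' := profile_upd i ph pu.
have cb k x : coord k (x - b) = coord k x - (k == i)%:R.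
  by rewrite lattice_coordB// [delta_mx _ _ _ _]mxE /=; case: (k == i).
have e x : coord_prod h x = coord_prod h' x - coord_prod h' (x - b).
  rewrite /coord_prod (bigD1 i)//= [X in X - _](bigD1 i)//= [X in _ - X](bigD1 i)//=.
  rewrite hi cb /h' /upd eqxx mulrBl; congr (_ * _ - _ * _).
    by apply: eq_bigr => k /negbTE ->.
  by apply: eq_bigr => k /negbTE ki; rewrite cb ki subr0.
have i1 := coord_prod_integrable Lp ph'; have i2 := coord_prod_integrable Lp ph.
have i3 : mu.-integrable setT (EFin \o (fun x => p x * coord_prod h' (x - b))).
  have := integrableB measurableT i1 i2; apply: eq_integrable => //.
  by move=> x _; rewrite /= -EFinD; congr EFin; rewrite e; ring.
rewrite /integral_on.
rewrite (@eq_Rintegral _ LRn R mu _ (fun x : Rn => p x * coord_prod h' x - p x * coord_prod h' (x - b))); last first.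
  by move=> x _; rewrite e mulrBr.
rewrite (RintegralB measurableT i1 i3); apply/eqP; rewrite subr_eq0; apply/eqP.
rewrite /Rintegral; congr fine.
rewrite -[RHS](integral_shift b); last by case/integrableP : i3.
apply: ae_eq_integral.
- exact: measurableT.
- by case/integrableP : i1.
- have m3 : measurable_fun [set: LRn] (EFin \o (fun x => p x * coord_prod h' (x - b)) : LRn -> \bar R).
    by case/integrableP : i3.
  exact: (measurableT_comp m3 (measurable_fun_shift b)).
- by apply: filterS (pp (delta_mx ord0 i)) => x px _; rewrite -/b px addrK.
Qed.

Definition heaviside (t : R) : R := (0 <= t)%R%:R.

Definition cell_indicator (t : R) : R := heaviside t - heaviside (t - 1).

Lemma measurable_heaviside : measurable_fun [set: R] heaviside.
Proof.
rewrite (_ : heaviside = \1_(`[(0 : R), +oo[%classic)).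
  exact: measurable_indic.
by apply/funext => t; rewrite indicE /heaviside; congr ((_ : bool)%:R);
  apply/idP/idP; rewrite inE /= in_itv /= andbT.
Qed.

Lemma measurable_shift1 u : measurable_fun [set: R] u ->
  measurable_fun [set: R] (fun t => u (t - 1)).
Proof.
move=> mu_; apply: (measurableT_comp mu_).
by apply: measurable_funB; [exact: measurable_id|exact: measurable_cst].
Qed.

Lemma profile_difference u : profile u -> (forall t : R, ~~ (0 <= t <= 1) -> u t = 0) ->
  profile (fun t => u t - u (t - 1)).
Proof.
move=> [mu_ [C uC] _] su; split.
- by apply: measurable_funB => //; exact: measurable_shift1.
- exists (C + C) => t; rewrite (le_trans (ler_normB _ _))//.
  by have := uC t; have := uC (t - 1); lra.
- move=> t; rewrite negb_and -!ltNge => t2.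
  by rewrite (su t) ?(su (t - 1)) ?subrr//; rewrite negb_and -!ltNge; lra.
Qed.

Lemma profile_step_deriv : profile (@step_deriv R).
Proof.
split.
- by apply: continuous_measurable_fun; exact: continuous_step_deriv.
- exact: step_deriv_bounded.
- move=> t; rewrite negb_and -!ltNge => t2.
  by rewrite step_deriv_out//; rewrite negb_and -!ltNge; lra.
Qed.

Lemma profile_hump_deriv : profile (@hump_deriv R).
Proof. exact/(profile_difference profile_step_deriv)/step_deriv_out. Qed.

Lemma step_out (t : R) : ~~ (0 <= t <= 1) -> step t - heaviside t = 0.
Proof.
rewrite negb_and -!ltNge => t01; rewrite /heaviside; case: lerP => t0.
  by rewrite step1 ?subrr//; lra.
by rewrite step0 ?subr0// ltW.
Qed.

Lemma profile_step_heaviside : profile (fun t => step t - heaviside t).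
Proof.
split.
- apply: measurable_funB; first by apply: continuous_measurable_fun; exact: continuous_step.
  exact: measurable_heaviside.
- exists 1 => t; rewrite /heaviside; have := step_itv t.
  by case: (0 <= t); rewrite /= ler_norml; lra.
- move=> t; rewrite negb_and -!ltNge => t2.
  by apply: step_out; rewrite negb_and -!ltNge; lra.
Qed.

Lemma profile_cell_indicator : profile cell_indicator.
Proof.
split.
- by apply: measurable_funB; [|apply: measurable_shift1]; exact: measurable_heaviside.
- exists 1 => t; rewrite /cell_indicator /heaviside.
  by case: (0 <= t); case: (0 <= t - 1); rewrite /= ler_norml; lra.
- move=> t; rewrite /cell_indicator /heaviside subr_ge0 negb_and -!ltNge.
  by case: (lerP 0 t) => t0; case: (lerP 1 t) => t1 /= t2; lra.
Qed.

Lemma hump_difference (t : R) : hump t - cell_indicator t =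
  (step t - heaviside t) - (step (t - 1) - heaviside (t - 1)).
Proof. by rewrite /hump /cell_indicator; ring. Qed.

Lemma profile_hump : profile (@hump R).
Proof.
have [m1 [C1 b1] s1] := profile_difference profile_step_heaviside step_out.
have [m2 [C2 b2] s2] := profile_cell_indicator.
have e (t : R) : hump t = (step t - heaviside t - (step (t - 1) - heaviside (t - 1))) + cell_indicator t.
  by rewrite -hump_difference subrK.
split.
- rewrite (_ : @hump R = fun t : R => (step t - heaviside t - (step (t - 1) - heaviside (t - 1))) + cell_indicator t).
    exact: measurable_funD.
  exact/funext.
- exists (C1 + C2) => t; rewrite e (le_trans (ler_normD _ _))//.
  by apply: lerD.
- by move=> t t2; rewrite e s1// s2// addr0.
Qed.

(** The humps are exchanged for indicators one coordinate at a time: the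
difference of two consecutive products has a telescoping factor, because [step]
and the Heaviside function agree outside [0, 1]. *)
Lemma integral_hump_cell p : L2loc p -> periodic A p ->
  integral_on setT (fun x => p x * coord_prod (fun=> @hump R) x) =
  integral_on setT (fun x => p x * coord_prod (fun=> cell_indicator) x).
Proof.
move=> Lp pp.
(* The first [m] coordinates carry indicators, the others humps. *)
pose hm (m : nat) : 'I_n.+1 -> R -> R := fun k => if (k < m)%N then cell_indicator else @hump R.
have phm m k : profile (hm m k).
  by rewrite /hm; case: ifP => _; [exact: profile_cell_indicator|exact: profile_hump].
suff step m : (m <= n.+1)%N -> integral_on setT (fun x => p x * coord_prod (hm 0%N) x) =
    integral_on setT (fun x => p x * coord_prod (hm m) x).
  have := step n.+1 (leqnn _); congr (_ = _); congr integral_on; apply/funext => x.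
  by congr (_ * _); apply: eq_bigr => k _; rewrite /hm ltn_ord.
elim: m => // m IH mn; rewrite IH; last exact: ltnW.
pose i : 'I_n.+1 := Ordinal mn.
pose g := upd (hm m) i (fun t => hump t - cell_indicator t).
have e x : coord_prod (hm m) x - coord_prod (hm m.+1) x = coord_prod g x.
  rewrite /coord_prod (bigD1 i)//= [X in _ - X](bigD1 i)//= [RHS](bigD1 i)//=.
  rewrite [X in _ * X - _](eq_bigr (fun k => g k (coord k x))); last first.
    by move=> k /negbTE ki; rewrite /g /upd ki.
  rewrite [X in _ - _ * X](eq_bigr (fun k => g k (coord k x))); last first.
    move=> k ki; rewrite /g /upd (negbTE ki) /hm ltnS leq_eqVlt.
    by rewrite -[_ == m]/(k == i) (negbTE ki).
  by rewrite -mulrBl /g /upd eqxx /hm /= ltnn ltnSn.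
have pg : profile (fun t => hump t - cell_indicator t).
  have := profile_difference profile_step_heaviside step_out.
  congr profile; apply/funext => t; exact/esym/hump_difference.
have := integral_periodic_telescope Lp pp (profile_upd i (phm m) pg) profile_step_heaviside.
move=> /(_ i) h0; apply/eqP; rewrite -subr_eq0; apply/eqP.
rewrite -[RHS]h0; last by move=> t; rewrite /upd eqxx hump_difference.
rewrite -(RintegralB measurableT (coord_prod_integrable Lp (phm m)) (coord_prod_integrable Lp (phm m.+1))).
by apply: eq_Rintegral => x _; rewrite -mulrBr e.
Qed.

Lemma integral_cell_indicator p :
  integral_on setT (fun x => p x * coord_prod (fun=> cell_indicator) x) =
  integral_on (parallelepiped A) p.
Proof.
rewrite /integral_on Rintegral_mkcond; apply: eq_Rintegral => x _.
rewrite patchE /coord_prod; case: ifPn => xQ.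
  rewrite big1 ?mulr1// => k _; rewrite /cell_indicator /heaviside subr_ge0.
  move: xQ; rewrite inE => /(_ k) /andP[-> x1].
  by rewrite leNgt x1 subr0.
have [k kx] : exists k, ~~ (0 <= coord k x < 1).
  apply: contrapT => /forallNP h; move/negP: xQ; apply; rewrite inE => k.
  by apply: contrapT => /negP; exact: h.
rewrite (bigD1 k)//= /cell_indicator /heaviside subr_ge0.
move: kx; rewrite negb_and -ltNge -leNgt.
by case: lerP => /= c0 c1; rewrite ?c1 ?subrr ?mul0r ?mulr0// leNgt (lt_trans c0)// subrr mul0r mulr0.
Qed.

Lemma Rintegral_sum (I : Type) (s : seq I) (F : I -> Rn -> R) :
  (forall i, mu.-integrable setT (EFin \o F i)) ->
  integral_on setT (fun x => \sum_(i <- s) F i x) = \sum_(i <- s) integral_on setT (F i).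
Proof.
move=> iF; elim: s => [|i s IH].
  rewrite big_nil /integral_on /Rintegral; under eq_integral do rewrite big_nil.
  by rewrite integral0.
rewrite big_cons -IH /integral_on -RintegralD//.
  by apply: eq_Rintegral => x _; rewrite big_cons.
rewrite (_ : EFin \o _ = fun x => (\sum_(i <- s) (F i x)%:E)%E).
  by apply: (@integrable_sum _ LRn) => // k _; exact: iF.
by apply/funext => x; rewrite /= sumEFin.
Qed.

(** A smooth partition of unity for the lattice: its translates add up to 1. *)
Definition bump : Rn -> R := coord_prod (fun=> @hump R).

Lemma tame_bump : tame bump.
Proof. by apply: tame_prod => k; exact: tame_hump. Qed.

Lemma test_function_bump : test_function bump.
Proof.
split; first exact/tame_smooth/tame_bump.
have [M bM] := coord_prod_support (fun=> profile_hump).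
apply: (subclosed_compact _ (@compact_cube R n M)); first exact: closed_closure.
rewrite (proj1 (closure_id (cube M)) (compact_closed_Rn (@compact_cube R n M))).
by apply: closureS => x; exact: bM.
Qed.

Lemma partial_bump j x : partial j bump x =
  \sum_k invmx A j k * coord_prod (upd (fun=> @hump R) k (@hump_deriv R)) x.
Proof.
have dk k : is_derive x (delta_mx ord0 j) (fun y => hump (coord k y))
    (hump_deriv (coord k x) * invmx A j k).
  have := @is_derive_comp_affine _ n (@hump R) (hump_deriv (coord k x)) 0 1 (invmx A) k x (delta_mx ord0 j).
  rewrite add0r !mul1r => /(_ (is_derive_hump _)).
  rewrite -rowE [row _ _ _ _]mxE; congr is_derive.
  by apply/funext => y; rewrite add0r mul1r.
rewrite /partial (@derive_val _ _ _ _ _ _ _ (is_derive_prod_ord dk)).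
apply: eq_bigr => k _; rewrite /coord_prod (bigD1 k)//= eqxx [in RHS](bigD1 k)//=.
rewrite /upd eqxx mulrA (mulrC (invmx A j k)); congr (_ * _).
by apply: eq_bigr => i /negbTE ->.
Qed.

(** Each term of the product rule has the telescoping factor [hump_deriv]. *)
Lemma integral_partial_bump p j : L2loc p -> periodic A p ->
  integral_on setT (fun x => p x * partial j bump x) = 0.
Proof.
move=> Lp pp.
pose F k x := (invmx A j k * p x) * coord_prod (upd (fun=> @hump R) k (@hump_deriv R)) x.
rewrite (_ : (fun x => _) = fun x => \sum_k F k x); last first.
  apply/funext => x; rewrite partial_bump mulr_sumr; apply: eq_bigr => k _.
  by rewrite /F; ring.
have LF k : L2loc (fun x => invmx A j k * p x).
  apply: (L2locM (C := `|invmx A j k|)) Lp; first exact: measurable_cst.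
  exact: aeW.
have ph k := profile_upd k (fun=> profile_hump) profile_hump_deriv.
rewrite Rintegral_sum => [|k]; last exact: coord_prod_integrable.
rewrite big1// => k _.
apply: (integral_periodic_telescope (i := k) (u := @step_deriv R)) => //.
- exact: (periodic_comp ( *%R (invmx A j k)) pp).
- exact: profile_step_deriv.
- by move=> t; rewrite /upd eqxx.
Qed.

Lemma integral_periodic_bump p : L2loc p -> periodic A p ->
  integral_on setT (fun x => p x * bump x) = integral_on V p.
Proof.
move=> Lp pp; rewrite integral_hump_cell// integral_cell_indicator.
by rewrite (integral_unit_cell cellV)//; case: Lp.
Qed.

(** Compatible strains average to zero: testing the weak gradient against [bump]
yields its cell average on one side and, on the other, the integral of the
periodic displacement against a derivative of a partition of unity. Only the
symmetric part of the gradient is known to be periodic, hence the contraction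
with [E] before the passage from the whole space to the cell. *)
Lemma pairing_cst_compatible (E : 'M[R]_n.+1) f : sym_mx E ->
  compatible_strains A f -> pairing V (cst E) f = 0.
Proof.
move=> sE [[sf Lf] [w [Dw [Hw HDw fDw]]]].
pose g x := ddot E (f x).
have Lg : L2loc g.
  apply: L2loc_sum => i; apply: L2loc_sum => j; apply: (L2locM (C := `|E i j|)) (Lf i j).2.
    exact: measurable_cst.
  exact: aeW.
have pg : periodic A g.
  have pf := ae_forall_count (fun i => ae_forall_count (fun j => (Lf i j).1 _)).
  move=> z; apply: filterS (pf z) => x fx.
  by apply: eq_bigr => i _; apply: eq_bigr => j _; rewrite fx.
have DwB i j : integral_on setT (fun x => Dw x i j * bump x) = 0.
  have [_ wD] := HDw i j; have [pw [Lw _]] := Hw i.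
  by apply/eqP; rewrite -oppr_eq0 -(wD _ test_function_bump) integral_partial_bump.
have iDw i j : mu.-integrable setT (EFin \o (fun x => E i j * Dw x i j * bump x)).
  apply: coord_prod_integrable => [|k]; last exact: profile_hump.
  apply: (L2locM (C := `|E i j|)) (HDw i j).1; first exact: measurable_cst.
  exact: aeW.
rewrite /pairing /average -/g; rewrite -(integral_periodic_bump Lg pg).
pose G x := \sum_(ij : 'I_n.+1 * 'I_n.+1) E ij.1 ij.2 * Dw x ij.1 ij.2 * bump x.
rewrite (_ : integral_on setT _ = integral_on setT G).
  rewrite Rintegral_sum => [|[i j]]; last exact: iDw.
  rewrite big1 ?mulr0// => -[i j] _ /=; rewrite /integral_on.
  rewrite (@eq_Rintegral _ LRn R mu _ (fun x : Rn => E i j * (Dw x i j * bump x))); last first.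
    by move=> x _; rewrite mulrA.
  rewrite RintegralZl//; first by rewrite [X in _ * X]DwB mulr0.
  by apply: coord_prod_integrable (HDw i j).1 _ => k; exact: profile_hump.
rewrite /integral_on /Rintegral; congr fine; apply: ae_eq_integral.
- exact: measurableT.
- have := coord_prod_integrable Lg (fun=> profile_hump).
  by case/integrableP.
- apply/measurable_EFinP; apply: (@measurable_sum _ LRn) => -[i j].
  by apply/measurable_EFinP; case/integrableP : (iDw i j).
apply: filterS fDw => x fx _; rewrite /g /G fx; congr EFin.
rewrite ddotZr ddotDr -ddotT sE -mulr_suml; congr (_ * _).
rewrite /ddot pair_bigA /=; lra.
Qed.

End periodic_cancellation.

(** * Projectors and gradients *)

Section gradients.
Context (R : realType) (n : nat) (A : 'M[R]_n.+1) (V : set 'rV[R]_n.+1).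
Hypothesis cellV : unit_cell A V.
Local Notation Rn := 'rV[R]_n.+1.
Local Notation field := (Rn -> 'M[R]_n.+1).
Local Notation H := (tensor_fields A).
Implicit Types (f g h : field) (K : Rn -> tensor4 R n.+1).

Lemma quadratic_slope (J : R -> R) (c d : R) :
  (forall t, J t - J 0 = t * c + t ^+ 2 * d) ->
  t^-1 * (J t - J 0) @[t --> 0^'] --> c.
Proof.
move=> Jt; have k : (fun t : R => c + t * d) @ 0^' --> c.
  apply: cvg_within_filter.
  have : (fun t : R => c + t * d) @ 0 --> c + 0 * d.
    by apply: cvgD; [exact: cvg_cst|apply: cvgM; [exact: cvg_id|exact: cvg_cst]].
  by rewrite mul0r addr0.
apply: cvg_trans k; apply: near_eq_cvg; near=> t.
have t0 : t != 0 by near: t; exact: nbhs_dnbhs_neq.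
by rewrite Jt; field.
Unshelve. all: by end_near. Qed.

Section projector.
Variables (K : Rn -> tensor4 R n.+1) (dot : field -> field -> R).
Hypothesis modK : moduli A K.
Hypothesis dotE : forall f g, H f -> H g -> dot f g = energy V K f g.
Variables (M : set field) (P : field -> field).
Hypotheses (MH : M `<=` H) (PM : orth_projector H dot M P).

Lemma projector_fields f : H f -> H (P f).
Proof. by move=> /PM[+ _]; exact: MH. Qed.

Lemma projector_orth f g : H f -> M g -> energy V K (f - P f) g = 0.
Proof.
move=> Hf Mg; have [_ [Hp /(_ _ Mg)]] := PM Hf.
by rewrite (dotE Hp (MH Mg)).
Qed.

(** The defect of linearity is orthogonal to [M] and is a combination of
elements of [M], hence is orthogonal to itself. *)
Lemma projector_linear f h (t : R) : H f -> H h ->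
  field_eq (P (f + t *: h)) (P f + t *: P h).
Proof.
move=> Hf Hh; have Hth := tensor_fieldsZ t Hh; have Hfh := tensor_fieldsD Hf Hth.
have Pf := projector_fields Hf; have Ph := projector_fields Hh.
have Pfh := projector_fields Hfh; have tPh := tensor_fieldsZ t Ph.
pose u := P (f + t *: h) - (P f + t *: P h).
have HPP := tensor_fieldsD Pf tPh; have Hu : H u := tensor_fieldsB Pfh HPP.
have uM g : M g -> energy V K u g = 0.
  move=> Mg; have Hg := MH Mg.
  have e1 := projector_orth Hf Mg; have e2 := projector_orth Hh Mg.
  have e3 := projector_orth Hfh Mg.
  rewrite (energyBl cellV modK Hfh Pfh Hg) (energyDl cellV modK Hf Hth Hg) in e3.
  rewrite (energyBl cellV modK Hf Pf Hg) in e1.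
  rewrite (energyBl cellV modK Hh Ph Hg) in e2.
  rewrite (energyZl cellV modK t Hh Hg) in e3.
  rewrite (energyBl cellV modK Pfh HPP Hg) (energyDl cellV modK Pf tPh Hg).
  rewrite (energyZl cellV modK t Ph Hg).
  have -> : energy V K (P f) g = energy V K f g by lra.
  have -> : energy V K (P h) g = energy V K h g by lra.
  lra.
have uu : energy V K u u = 0.
  rewrite {2}/u (energyBr cellV modK Pfh HPP Hu) (energyDr cellV modK Pf tPh Hu).
  rewrite (energyZr cellV modK t Ph Hu) !uM ?mulr0 ?addr0 ?subr0//.
  - by case: (PM Hh).
  - by case: (PM Hf).
  - by case: (PM Hfh).
apply: filterS (energy_eq0 cellV modK Hu uu) => x ux.
by apply/eqP; rewrite -subr_eq0; apply/eqP.
Qed.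

End projector.

(** The difference of two gradients is orthogonal to itself. *)
Lemma gradient_unique K (dot : field -> field -> R) (J : field -> R) f g g' :
  moduli A K -> (forall f g, H f -> H g -> dot f g = energy V K f g) ->
  is_gradient H dot J f g -> is_gradient H dot J f g' -> field_eq g' g.
Proof.
move=> modK dotE [Hg gJ] [Hg' gJ']; have Hu := tensor_fieldsB Hg' Hg.
have e : energy V K (g' - g) (g' - g) = 0.
  rewrite (energyBl cellV modK Hg' Hg Hu) -!dotE//.
  apply/eqP; rewrite subr_eq0; apply/eqP.
  exact: (cvg_unique _ (gJ' _ Hu) (gJ _ Hu)).
apply: filterS (energy_eq0 cellV modK Hu e) => x ux.
by apply/eqP; rewrite -subr_eq0; apply/eqP.
Qed.

(** The difference quotient along a line is affine in [t], so its limit is the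
linear coefficient; uniqueness is [gradient_unique]. *)
Lemma gradient_eq_quadratic K (dot : field -> field -> R) (J : field -> R) f g :
  moduli A K -> (forall f g, H f -> H g -> dot f g = energy V K f g) -> H g ->
  (forall h, H h -> exists d, forall t : R,
     J (f + t *: h) - J f = t * energy V K g h + t ^+ 2 * d) ->
  gradient_eq H dot J f g.
Proof.
move=> modK dotE Hg Jq; have G : is_gradient H dot J f g.
  split=> // h Hh; have [d Jd] := Jq h Hh; rewrite dotE//.
  have f0 : f + 0 *: h = f by rewrite scale0r addr0.
  have := @quadratic_slope (fun t => J (f + t *: h)) (energy V K g h) d.
  by rewrite f0; apply.
by split=> // g'; exact: gradient_unique modK dotE G.
Qed.

(** The pointwise inverse and the explicit compliance tensor agree almost
everywhere only, hence the detour through [pairing]. *)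
Lemma average_residual L tau eta : elasticity_field A V L -> H tau -> H eta ->
  average V (fun x => residual L x tau eta) =
  2^-1 * energy V (fun x => inv_tensor (L x))
    (tau - field_apply L eta) (tau - field_apply L eta).
Proof.
move=> elL Ht He; have modL := moduli_elasticity cellV elL.
set r := tau - field_apply L eta.
have Hr : H r := tensor_fieldsB Ht (tensor_fields_apply modL He).
have Hs := tensor_fields_apply (moduli_compliance cellV elL) Hr.
have eS := field_inv_ae modL Hr.
rewrite (_ : average _ _ = 2^-1 * pairing V r (field_inv L r)).
  by rewrite pairingC /energy (pairing_ael cellV Hs Hr eS).
have Hi := tensor_fields_ae eS Hs.
rewrite /pairing /average mulrCA; congr (_ * _).
have mV : measurable (V : set (lebesgue_space R n)) by case: cellV.
by rewrite -[RHS](RintegralZl _ mV (ddot_integrable cellV Hr Hi)).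
Qed.

Lemma field_inv_apply K f : moduli A K -> H f ->
  field_eq (field_apply (fun x => inv_tensor (K x)) (field_apply K f)) f.
Proof.
move=> [_ _ sK _] [sf _]; apply: filterS2 sK sf => x [sKx pKx] sfx.
rewrite /field_apply -(tensor_invE sKx pKx); last exact: tensor_apply_sym.
exact: tensor_inv_unique.
Qed.

Lemma energy_sqrD K f h (t : R) : moduli A K -> H f -> H h ->
  energy V K (f + t *: h) (f + t *: h) =
  energy V K f f + t * (2 * energy V K f h) + t ^+ 2 * energy V K h h.
Proof.
move=> modK Hf Hh; have Ht := tensor_fieldsZ t Hh; have Hft := tensor_fieldsD Hf Ht.
rewrite (energyDl cellV modK Hf Ht Hft) (energyDr cellV modK Hf Ht Hf).
rewrite (energyDr cellV modK Hf Ht Ht) !(energyZl cellV modK t Hh) ?(energyZr cellV modK t Hh) //.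
by rewrite (energyC cellV modK Hh Hf); ring.
Qed.

Lemma energy_ae2 K f f' : moduli A K -> H f -> field_eq f f' ->
  energy V K f f = energy V K f' f'.
Proof.
move=> modK Hf ff'; have Hf' := tensor_fields_ae ff' Hf.
rewrite (energy_ael cellV modK Hf Hf ff') (energyC cellV modK Hf' Hf).
exact: (energy_ael cellV modK Hf Hf' ff').
Qed.

Lemma dot_normE K (dot : field -> field -> R) f : moduli A K ->
  (forall f g, H f -> H g -> dot f g = energy V K f g) -> H f ->
  dot_norm dot f ^+ 2 = energy V K f f.
Proof.
move=> modK dotE Hf; rewrite /dot_norm (dotE _ _ Hf Hf) sqr_sqrtr//.
exact: (energy_ge0 cellV modK Hf).
Qed.

End gradients.

Theorem proposition4 (R : realType) (n : nat)
    (A : 'M[R]_n.+1) (V : set 'rV[R]_n.+1)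
    (L0 : tensor4 R n.+1) (L : 'rV[R]_n.+1 -> tensor4 R n.+1)
    (PE PSorth : ('rV[R]_n.+1 -> 'M[R]_n.+1) -> ('rV[R]_n.+1 -> 'M[R]_n.+1))
    (ebar : 'rV[R]_n.+1 -> 'M[R]_n.+1) :
  let He := tensor_fields A in
  let Hs := tensor_fields A in
  let dot_e := strain_dot V L0 in
  let dot_s := stress_dot V L0 in
  let P := objective V L0 L PE PSorth ebar in
  unit_cell A V ->
  tensor_symmetric L0 -> tensor_posdef L0 ->
  elasticity_field A V L ->
  orth_projector He dot_e (compatible_strains A) PE ->
  orth_projector Hs dot_s (orth Hs dot_s (equilibrated_stresses A)) PSorth ->
  uniform_fields A ebar ->
  forall tau eta, Hs tau -> He eta ->
    gradient_eq Hs dot_s (fun t => P t eta) tau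
      (field_apply (fun=> L0) (field_inv L tau - eta) + PSorth tau) /\
    gradient_eq He dot_e (fun e => P tau e) eta
      (field_inv (fun=> L0) (field_apply L eta - tau) + (eta - PE eta) - ebar).
Proof.
move=> H Hs; change Hs with H; clear Hs.
move=> dot_e dot_s P cellV sL0 pL0 elL projE projS [Hebar [E ebarE]] tau eta Ht He.
have modD : moduli A (fun=> L0) := moduli_cst A sL0 pL0.
have modS : moduli A (fun=> inv_tensor L0).
  by apply: moduli_cst; [exact: inv_tensor_symmetric|exact: inv_tensor_posdef].
have modL := moduli_elasticity cellV elL; have modC := moduli_compliance cellV elL.
set C := fun x => inv_tensor (L x) in modC.
have dot_eE f g : H f -> H g -> dot_e f g = energy V (fun=> L0) f g by [].
have dot_sE f g : H f -> H g -> dot_s f g = energy V (fun=> inv_tensor L0) f g.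
  move=> Hf Hg; rewrite (energyC cellV modS Hf Hg) /energy.
  rewrite (pairing_ael cellV (tensor_fields_apply modS Hg) Hf (field_inv_ae modD Hg)).
  by rewrite pairingC.
have MS : orth H dot_s (equilibrated_stresses A) `<=` H by move=> f [].
have ME : compatible_strains A `<=` H by move=> f [].
have HPS f : H f -> H (PSorth f) := projector_fields MS projS (f := f).
have HPE f : H f -> H (PE f) := projector_fields ME projE (f := f).
set r := tau - field_apply L eta.
have HLeta := tensor_fields_apply modL He.
have Hr : H r := tensor_fieldsB Ht HLeta.
have HiL f : H f -> H (field_inv L f).
  by move=> Hf; exact: (tensor_fields_ae (field_inv_ae modL Hf) (tensor_fields_apply modC Hf)).
set u := field_inv L tau - eta.
have Hu : H u := tensor_fieldsB (HiL _ Ht) He.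
have Cr : field_eq (field_apply C r) u.
  apply: filterS2 (field_inv_ae modL Ht) (field_inv_apply modL He) => x et ee.
  rewrite /r /u -[(field_inv L tau - eta) x]/(field_inv L tau x - eta x) -et -ee.
  exact: tensor_applyB.
set v := eta - PE eta - ebar.
have Hv : H v := tensor_fieldsB (tensor_fieldsB He (HPE _ He)) Hebar.
split.
- have HDu := tensor_fields_apply modD Hu.
  apply: (gradient_eq_quadratic cellV modS dot_sE).
    exact: (tensor_fieldsD HDu (HPS _ Ht)).
  move=> h Hh; exists (2^-1 * energy V C h h +
      2^-1 * energy V (fun=> inv_tensor L0) (PSorth h) (PSorth h)) => t.
  have Hth := tensor_fieldsZ t Hh; have Htth := tensor_fieldsD Ht Hth.
  rewrite /P /objective (average_residual cellV elL Htth He) (average_residual cellV elL Ht He).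
  rewrite (dot_normE cellV modS dot_sE (HPS _ Htth)) (dot_normE cellV modS dot_sE (HPS _ Ht)).
  have -> : tau + t *: h - field_apply L eta = r + t *: h by rewrite addrAC.
  rewrite (energy_sqrD cellV t modC Hr Hh).
  rewrite (energy_ae2 cellV modS (HPS _ Htth) (projector_linear cellV modS dot_sE MS projS t Ht Hh)).
  rewrite (energy_sqrD cellV t modS (HPS _ Ht) (HPS _ Hh)).
  rewrite (energyDl cellV modS HDu (HPS _ Ht) Hh).
  have -> : energy V C r h = pairing V u h.
    exact: (pairing_ael cellV (tensor_fields_apply modC Hr) Hh Cr).
  have -> : energy V (fun=> inv_tensor L0) (field_apply (fun=> L0) u) h = pairing V u h.
    exact: (pairing_ael cellV (tensor_fields_apply modS HDu) Hh (field_inv_apply modD Hu)).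
  (* [P h] may be replaced by [h] against [P tau], which lies in the range. *)
  have := projector_orth dot_sE MS projS Hh (projS _ Ht).1.
  rewrite (energyBl cellV modS Hh (HPS _ Hh) (HPS _ Ht)).
  rewrite (energyC cellV modS Hh (HPS _ Ht)) (energyC cellV modS (HPS _ Hh) (HPS _ Ht)).
  by move/eqP; rewrite subr_eq0 => /eqP ->; field.
- have HmLt : H (field_apply L eta - tau) := tensor_fieldsB HLeta Ht.
  have HiD : H (field_inv (fun=> L0) (field_apply L eta - tau)).
    exact: (tensor_fields_ae (field_inv_ae modD HmLt) (tensor_fields_apply modS HmLt)).
  have -> : field_inv (fun=> L0) (field_apply L eta - tau) + (eta - PE eta) - ebar =
            field_inv (fun=> L0) (field_apply L eta - tau) + v by rewrite /v -[LHS]addrA.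
  apply: (gradient_eq_quadratic cellV modD dot_eE); first exact: (tensor_fieldsD HiD Hv).
  move=> h Hh; have HLh := tensor_fields_apply modL Hh.
  have HhP := tensor_fieldsB Hh (HPE _ Hh).
  exists (2^-1 * energy V (fun=> L0) (h - PE h) (h - PE h) +
      2^-1 * energy V C (field_apply L h) (field_apply L h)) => t.
  have Hth := tensor_fieldsZ t Hh; have Heth := tensor_fieldsD He Hth.
  have Hv' := tensor_fieldsB (tensor_fieldsB Heth (HPE _ Heth)) Hebar.
  rewrite /P /objective (average_residual cellV elL Ht Heth) (average_residual cellV elL Ht He).
  rewrite (dot_normE cellV modD dot_eE Hv') (dot_normE cellV modD dot_eE Hv).
  have vt : field_eq (eta + t *: h - PE (eta + t *: h) - ebar) (v + t *: (h - PE h)).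
    apply: filterS (projector_linear cellV modD dot_eE ME projE t He Hh) => x ex.
    rewrite -[LHS]/(eta x + t *: h x - PE (eta + t *: h) x - ebar x) ex.
    rewrite -[RHS]/(eta x - PE eta x - ebar x + t *: (h x - PE h x)).
    rewrite -[(PE eta + _) x]/(PE eta x + t *: PE h x).
    by apply/matrixP => i j; rewrite !mxE; ring.
  rewrite (energy_ae2 cellV modD Hv' vt) (energy_sqrD cellV t modD Hv HhP).
  have -> : tau - field_apply L (eta + t *: h) = r + (- t) *: field_apply L h.
    apply/funext => x; rewrite -[RHS]/(tau x - field_apply L eta x + (- t) *: field_apply L h x).
    rewrite -[LHS]/(tau x - tensor_apply (L x) (eta x + t *: h x)).
    by rewrite tensor_applyD tensor_applyZ scaleNr opprD addrA.
  rewrite (energy_sqrD cellV (- t) modC Hr HLh).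
  rewrite (energyDl cellV modD HiD Hv Hh) (energy_inv cellV modD HmLt Hh).
  have -> : energy V C r (field_apply L h) = pairing V r h.
    rewrite (energyC cellV modC Hr HLh) pairingC.
    exact: (pairing_ael cellV (tensor_fields_apply modC HLh) Hr (field_inv_apply modL Hh)).
  have -> : pairing V (field_apply L eta - tau) h = - pairing V r h.
    by rewrite (pairingBl cellV HLeta Ht Hh) (pairingBl cellV Ht HLeta Hh) opprB.
  have -> : energy V (fun=> L0) v (h - PE h) = energy V (fun=> L0) v h.
    rewrite (energyBr cellV modD Hh (HPE _ Hh) Hv).
    have -> : energy V (fun=> L0) v (PE h) = 0; last by rewrite subr0.
    rewrite (energyBl cellV modD (tensor_fieldsB He (HPE _ He)) Hebar (HPE _ Hh)).
    rewrite (projector_orth dot_eE ME projE He (projE _ Hh).1) sub0r.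
    apply/eqP; rewrite oppr_eq0; apply/eqP.
    (* The uniform strain [ebar] enters through the constant stress [L0 E]. *)
    rewrite -(pairing_cst_compatible cellV (tensor_apply_sym E sL0) (projE _ Hh).1).
    apply: (pairing_ael cellV (tensor_fields_apply modD Hebar) (HPE _ Hh)).
    by apply: filterS ebarE => x; rewrite /field_apply => ->.
  by field.
Qed.
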